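(* Let $D$ be an integral domain, let $K$ be a field containing $D$ as a subring, and let $\mathcal{X}$ be a projective model of $K$ over $D$. Let $D^{*}=\bigcap_{R\in\mathcal{X}}R(t)$, and let $\delta:\mathcal{S}(D^{*})\to\mathcal{X}$ be the domination map, which sends each $R^{*}\in\mathcal{S}(D^{*})$ to the unique element of $\mathcal{X}$ dominated by $R^{*}$. Then $\delta$ is a morphism of schemes from the affine scheme $\mathcal{S}(D^{*})=\operatorname{Spec}D^{*}$ to the scheme $(\mathcal{X},\mathcal{O}_{\mathcal{X}})$, and this morphism is faithfully flat.
   Context: Rings are commutative with identity; local rings need not be Noetherian. $D$ is an integral domain, $K$ a field containing $D$, $t$ an indeterminate. $\mathcal{L}(K/D)$ is the set of local domains $R$ with $D\subseteq R\subseteq K$ and fraction field $K$. For an integral domain $A$, $\mathcal{S}(A)=\{A_P : P \text{ a prime ideal of } A\}$ (subrings of the fraction field of $A$), identified with $\operatorname{Spec}A$ via $A_P\leftrightarrow P$. A local domain $(S,M_S)$ dominates a local domain $(R,M_R)$ if $R$ is a subring of $S$ and $M_R=M_S\cap R$. A premodel of $K$ over $D$ is a nonempty subset of $\mathcal{L}(K/D)$. For a subset $H\subseteq K$ containing a nonzero element, $\mathcal{W}(D;H)=\bigcup_{0\ne x\in H}\mathcal{S}(D[Hx^{-1}])$, where $D[Hx^{-1}]$ is the subring of $K$ generated by $D$ and all $yx^{-1}$, $y\in H$. A projective model of $K$ over $D$ is a premodel of $K$ over $D$ of the form $\mathcal{W}(D;H)$ with $H\subseteq K$ finite and containing a nonzero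 element. The Zariski topology on $\mathcal{X}\subseteq\mathcal{L}(K/D)$ has as basis the sets $\{R\in\mathcal{X}: R\supseteq H\}$, $H\subseteq K$ finite. The structure sheaf is $\mathcal{O}_{\mathcal{X}}(U)=\bigcap_{R\in U}R$ for nonempty open $U$ (the zero ring for $U=\emptyset$), with inclusions as restriction maps; with it $\mathcal{X}$ is a scheme whose stalk at $R$ is $R$. A polynomial in $R[t]$ is primitive if its coefficients generate the unit ideal of $R$. The Nagata extension $R(t)$ is the localization of $R[t]$ at the multiplicative set of all primitive polynomials. For $R\in\mathcal{X}$, $R(t)$ is viewed as a subring of $K(t)$, so $D^{*}$ is a subring of $K(t)$. Every element of $\mathcal{S}(D^{*})$ dominates exactly one element of $\mathcal{X}$, so $\delta$ is well defined as a map. On sheaves, the morphism is given by the inclusions $\mathcal{O}_{\mathcal{X}}(U)\subseteq\mathcal{O}_{\operatorname{Spec}D^{*}}(\delta^{-1}(U))$ inside $K(t)$. *)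

(* Defs.v *)
From HB Require Import structures.
From mathcomp Require Import all_boot all_order all_algebra.
From mathcomp Require Import fraction.
From mathcomp Require Import boolp classical_sets functions cardinality.
From mathcomp Require Import topology.

Set Implicit Arguments.
Unset Strict Implicit.
Unset Printing Implicit Defensive.

Import GRing.Theory.

Local Open Scope classical_set_scope.
Local Open Scope ring_scope.

Section Ideals.
Context {R : comPzRingType}.
Implicit Types I J : set R.

Definition ideal I :=
  [/\ I 0, forall x y, I x -> I y -> I (x + y) & forall a x, I x -> I (a * x)].

Definition prime_ideal I :=
  [/\ ideal I, ~ I 1 & forall x y, I (x * y) -> I x \/ I y].

Definition maximal_ideal I :=
  [/\ ideal I, ~ I 1 & forall J, ideal J -> ~ J 1 -> I `<=` J -> J = I].

End Ideals.

Definition local_ring (R : comPzRingType) :=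
  exists! M : set R, maximal_ideal M.

(* The maximal ideal of a local ring; meaningless if R is not local. *)
Definition maxid (R : comPzRingType) : set R :=
  xget set0 [set M : set R | maximal_ideal M].
Arguments maxid R : clear implicits.

Definition local_hom (A B : comPzRingType) (phi : A -> B) :=
  forall a, maxid B (phi a) <-> maxid A a.

(* The tensor product of the A-module M with B, viewed as an A-module through
   phi, is the set of formal sums of pairs (m, b), written as lists, modulo the
   congruence [tensor_eq]; the pair (m, b) stands for the pure tensor of m and
   b. Opposites exist in the quotient, as (- m, b) is the opposite of (m, b). *)
Inductive tensor_eq (A B : comPzRingType) (phi : A -> B) (M : lmodType A) :
    seq (M * B) -> seq (M * B) -> Prop :=
| tensor_refl u : tensor_eq phi u u
| tensor_sym u v : tensor_eq phi u v -> tensor_eq phi v u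
| tensor_trans u v w :
    tensor_eq phi u v -> tensor_eq phi v w -> tensor_eq phi u w
| tensor_cat u u' v v' :
    tensor_eq phi u u' -> tensor_eq phi v v' -> tensor_eq phi (u ++ v) (u' ++ v')
| tensor_catC u v : tensor_eq phi (u ++ v) (v ++ u)
| tensor_addl m m' b : tensor_eq phi [:: (m + m', b)] [:: (m, b); (m', b)]
| tensor_addr m b b' : tensor_eq phi [:: (m, b + b')] [:: (m, b); (m, b')]
| tensor_scale a m b : tensor_eq phi [:: (a *: m, b)] [:: (m, phi a * b)]
| tensor_zero b : tensor_eq phi [:: (0, b)] [::].

(* Tensoring with B preserves injectivity of A-linear maps. *)
Definition flat_hom (A B : comPzRingType) (phi : {rmorphism A -> B}) :=
  forall (M N : lmodType A) (f : {linear M -> N}), injective f ->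
  forall u v : seq (M * B),
    tensor_eq phi [seq (f w.1, w.2) | w <- u] [seq (f w.1, w.2) | w <- v] ->
    tensor_eq phi u v.

Record opens (T : topologicalType) := Opens {
  oset :> set T;
  osetP : open oset
}.

Definition opens_setT (T : topologicalType) : opens T := Opens (@openT T).

Definition opens_preim (S T : topologicalType) (f : S -> T)
    (cf : continuous f) (V : opens T) : opens S :=
  Opens (open_comp (fun x _ => cf x) (osetP V)).

(* A topological space with a presheaf of commutative rings, together with the
   stalks: the fields [germ_res], [germ_surj] and [germ_eq] say that [stalk x]
   is the direct limit of the rings [sect U] over the open sets U containing x.
   The sheaf axiom is the separate predicate [is_sheaf]. *)
Record ringed_space := RingedSpace {
  rs_space :> topologicalType;
  sect : opens rs_space -> comPzRingType;
  res : forall U V : opens rs_space, V `<=` U -> {rmorphism sect U -> sect V};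
  res_id : forall (U : opens rs_space) (h : U `<=` U) (s : sect U), res h s = s;
  res_comp : forall (U V W : opens rs_space)
    (hVU : V `<=` U) (hWV : W `<=` V) (hWU : W `<=` U) (s : sect U),
    res hWV (res hVU s) = res hWU s;
  stalk : rs_space -> comPzRingType;
  germ : forall (U : opens rs_space) (x : rs_space),
    oset U x -> {rmorphism sect U -> stalk x};
  germ_res : forall (U V : opens rs_space) (hVU : V `<=` U) (x : rs_space)
    (Ux : oset U x) (Vx : oset V x) (s : sect U),
    germ Vx (res hVU s) = germ Ux s;
  germ_surj : forall (x : rs_space) (a : stalk x),
    exists (U : opens rs_space) (Ux : oset U x) (s : sect U), germ Ux s = a;
  germ_eq : forall (x : rs_space) (U : opens rs_space) (Ux : oset U x)
    (s s' : sect U), germ Ux s = germ Ux s' ->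
    exists (V : opens rs_space) (hVU : V `<=` U),
      oset V x /\ res hVU s = res hVU s'
}.

Definition is_sheaf (X : ringed_space) :=
  forall (I : Type) (U : opens X) (W : I -> opens X)
    (hW : forall i, W i `<=` U), U `<=` \bigcup_i W i ->
  forall s : forall i, sect (W i),
    (forall i j (V : opens X) (hi : V `<=` W i) (hj : V `<=` W j),
       res hi (s i) = res hj (s j)) ->
    exists! s0 : sect U, forall i, res (hW i) s0 = s i.

Definition locally_ringed (X : ringed_space) :=
  forall x : X, local_ring (stalk x).

Section Affine.
Variables (X : ringed_space) (U : opens X) (A : comPzRingType).
Variable phi : {rmorphism A -> sect U}.

Definition point_prime (x : X) : set A :=
  [set a | forall Ux : oset U x, maxid (stalk x) (germ Ux (phi a))].

Definition basic_open (a : A) : set X :=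
  [set x | oset U x /\ ~ point_prime x a].

(* Through phi, the open subspace U is Spec A: its points correspond to the
   primes of A, its topology has the sets D(a) as a basis, and A -> O(D(a)) is a
   localization of A at the powers of a (with a = 1, phi is bijective). *)
Definition is_spec_via :=
  [/\ set_bij U [set P | prime_ideal P] point_prime,
      forall V : set X, V `<=` U ->
        (open V <-> forall x, V x ->
           exists a, basic_open a x /\ basic_open a `<=` V)
    & forall (a : A) (V : opens X) (hVU : V `<=` U), oset V = basic_open a ->
        [/\ exists v, res hVU (phi a) * v = 1,
            forall s : sect V, exists (b : A) (n : nat),
              s * res hVU (phi a) ^+ n = res hVU (phi b)
          & forall b : A, res hVU (phi b) = 0 -> exists n : nat, a ^+ n * b = 0]].

End Affine.

Definition is_scheme (X : ringed_space) :=
  [/\ is_sheaf X, locally_ringed X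
    & forall x : X, exists (U : opens X) (A : comPzRingType)
        (phi : {rmorphism A -> sect U}), oset U x /\ is_spec_via phi].

Definition is_Spec (A : comPzRingType) (X : ringed_space) :=
  [/\ is_sheaf X, locally_ringed X
    & exists phi : {rmorphism A -> sect (opens_setT X)}, is_spec_via phi].

(* [mor_stalk] is determined by [mor_sect] through [mor_germ]. *)
Record ringed_morphism (X Y : ringed_space) := RingedMorphism {
  mor_fun :> X -> Y;
  mor_cont : continuous mor_fun;
  mor_sect : forall V : opens Y,
    {rmorphism sect V -> sect (opens_preim mor_cont V)};
  mor_res : forall (V W : opens Y) (hWV : W `<=` V)
    (h : opens_preim mor_cont W `<=` opens_preim mor_cont V) (s : sect V),
    mor_sect W (res hWV s) = res h (mor_sect V s);
  mor_stalk : forall x : X, {rmorphism stalk (mor_fun x) -> stalk x};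
  mor_germ : forall (V : opens Y) (x : X) (Vx : oset V (mor_fun x))
    (Vx' : oset (opens_preim mor_cont V) x) (s : sect V),
    mor_stalk x (germ Vx s) = germ Vx' (mor_sect V s)
}.

Definition scheme_morphism (X Y : ringed_space) (f : ringed_morphism X Y) :=
  [/\ is_scheme X, is_scheme Y & forall x, local_hom (mor_stalk f x)].

Definition faithfully_flat (X Y : ringed_space) (f : ringed_morphism X Y) :=
  (forall x, flat_hom (mor_stalk f x)) /\ (forall y, exists x, f x = y).

Record subring (F : fieldType) := Subring {
  carrier :> set F;
  subringP : GRing.subring_closed (fun x : F => x \in carrier)
}.

HB.instance Definition _ (F : fieldType) := gen_eqMixin (subring F).
HB.instance Definition _ (F : fieldType) := gen_choiceMixin (subring F).

Definition subring_type (F : fieldType) (A : subring F) : Type :=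
  {x : F | x \in carrier A}.

Section SubringType.
Variables (F : fieldType) (A : subring F).
HB.instance Definition _ := SubChoice.on (subring_type A).
HB.instance Definition _ :=
  GRing.SubChoice_isSubComPzRing.Build F (fun x : F => x \in carrier A)
    (subring_type A) (subringP A).
End SubringType.

Section SubringOps.
Variable F : fieldType.

Lemma bigcap_subring_closed (I : Type) (P : set I) (A : I -> subring F) :
  GRing.subring_closed (fun x : F => x \in \bigcap_(i in P) carrier (A i)).
Proof.
split=> [|x y|x y]; rewrite !unfold_in.
- by apply/mem_set => i _; have [/set_mem] := subringP (A i).
- move=> /set_mem Ax /set_mem Ay; apply/mem_set => i Pi.
  have [_ AB _] := subringP (A i).
  by apply/set_mem/AB; apply/mem_set; [exact: Ax | exact: Ay].
- move=> /set_mem Ax /set_mem Ay; apply/mem_set => i Pi.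
  have [_ _ AM] := subringP (A i).
  by apply/set_mem/AM; apply/mem_set; [exact: Ax | exact: Ay].
Qed.

Definition bigcap_subring (I : Type) (P : set I) (A : I -> subring F) :
  subring F := Subring (bigcap_subring_closed P A).

Definition generated_subring (S : set F) : subring F :=
  bigcap_subring [set A : subring F | S `<=` A] id.

(* For A a ring and S multiplicatively closed, the fractions a / s already form
   a subring (lemma [localizationE] below). *)
Definition localization (A S : set F) : subring F :=
  generated_subring [set a / s | a in A & s in S].

Lemma localizationE (A : subring F) (S : set F) :
  S 1 -> (forall x y, S x -> S y -> S (x * y)) -> ~ S 0 -> S `<=` A ->
  carrier (localization A S) = [set a / s | a in carrier A & s in S].
Proof.
move=> S1 SM S0 SA; set B := [set a / s | a in carrier A & s in S].
have [A1 AB AM] := subringP A.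
have Bs : GRing.subring_closed (fun x : F => x \in B).
  have S_neq0 s : S s -> s != 0 by move=> Ss; apply/eqP => s0; rewrite s0 in Ss.
  split=> [|x y|x y]; rewrite !unfold_in.
  - by apply/mem_set; exists 1; [exact: set_mem | exists 1 => //; rewrite divr1].
  - move=> /set_mem [a Aa [s Ss <-]] /set_mem [b Ab [r Sr <-]].
    apply/mem_set; exists (a * r - b * s).
      by apply/set_mem/AB; apply/AM; apply/mem_set => //; exact: SA.
    exists (s * r); first exact: SM.
    by rewrite -[- (b / r)]mulNr addf_div ?S_neq0// mulNr.
  - move=> /set_mem [a Aa [s Ss <-]] /set_mem [b Ab [r Sr <-]].
    apply/mem_set; exists (a * b).
      by apply/set_mem/AM; apply/mem_set.
    exists (s * r); first exact: SM.
    by rewrite mulf_div.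
apply/seteqP; split=> [x|x Bx C CB]; last exact: CB.
by move=> /(_ (Subring Bs)); apply => y.
Qed.

Definition localizations (A : subring F) : set (subring F) :=
  [set R | exists P : set (subring_type A), prime_ideal P /\
     R = localization A [set val x | x in ~` P]].

End SubringOps.

Section ZariskiSpace.
Variables (F : fieldType) (X : set (subring F)).

Definition zariski : Type := set_type X.
HB.instance Definition _ := Choice.on zariski.

Definition ring_of (x : zariski) : subring F := set_val x.

Definition zariski_basic (H : set F) : set zariski :=
  [set x | H `<=` ring_of x].

Lemma zariski_cover : \bigcup_(H in @finite_set F) zariski_basic H = setT.
Proof. by apply/seteqP; split=> // x _; exists set0. Qed.

Lemma zariski_join (H J : set F) (x : zariski) :
  finite_set H -> finite_set J -> zariski_basic H x -> zariski_basic J x ->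
  exists L, [/\ finite_set L, zariski_basic L x &
    zariski_basic L `<=` zariski_basic H `&` zariski_basic J].
Proof.
move=> fH fJ Hx Jx; exists (H `|` J); split.
- by rewrite finite_setU.
- by move=> y [/Hx|/Jx].
- by move=> y HJy; split=> z zH; apply: HJy; [left | right].
Qed.

HB.instance Definition _ :=
  isBaseTopological.Build zariski zariski_cover zariski_join.

(* The elements of O(U) are encoded as the constant functions from U to F whose
   value lies in every R in U. For nonempty U this is the intersection of the
   rings in U (lemma [zsectE] below); for empty U it is the zero ring. The
   value of a section at a point is also its germ there. *)
Definition zsect_set (U : set zariski) : set (set_type U -> F) :=
  [set s | (exists c, forall x, s x = c) /\
           forall x, carrier (ring_of (set_val x)) (s x)].
Arguments zsect_set U : clear implicits.

Lemma zsect_closed (U : set zariski) :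
  GRing.subring_closed (fun s => s \in zsect_set U).
Proof.
have AP (x : set_type U) := subringP (ring_of (set_val x)).
split=> [|s r|s r]; rewrite !unfold_in.
- apply/mem_set; split; first by exists 1.
  by move=> x; have [/set_mem] := AP x.
- move=> /set_mem [[c sc] sR] /set_mem [[d rd] rR]; apply/mem_set; split.
    by exists (c - d) => x; rewrite -(sc x) -(rd x).
  by move=> x; have [_ AB _] := AP x; apply/set_mem/AB; apply/mem_set.
- move=> /set_mem [[c sc] sR] /set_mem [[d rd] rR]; apply/mem_set; split.
    by exists (c * d) => x; rewrite -(sc x) -(rd x).
  by move=> x; have [_ _ AM] := AP x; apply/set_mem/AM; apply/mem_set.
Qed.

Definition zsect (U : set zariski) : Type :=
  {s : set_type U -> F | s \in zsect_set U}.
HB.instance Definition _ (U : set zariski) := SubChoice.on (zsect U).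
HB.instance Definition _ (U : set zariski) :=
  GRing.SubChoice_isSubComPzRing.Build (set_type U -> F)
    (fun s => s \in zsect_set U) (zsect U) (zsect_closed U).

Definition zvalue (U : set zariski) (s : zsect U) (x : zariski) (Ux : U x) : F :=
  val s (exist _ x (mem_set Ux)).

Lemma zvalueE (U : set zariski) (s : zsect U) (y : set_type U)
  (Uy : U (set_val y)) : val s y = zvalue s Uy.
Proof. by congr (val s _); apply: val_inj. Qed.

Lemma zvalue_cst (U : set zariski) (s : zsect U) (x y : zariski)
  (Ux : U x) (Uy : U y) : zvalue s Ux = zvalue s Uy.
Proof. by have [[c sc] _] := set_mem (valP s); rewrite /zvalue !sc. Qed.

Lemma zvalueP (U : set zariski) (s : zsect U) (x : zariski) (Ux : U x) :
  carrier (ring_of x) (zvalue s Ux).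
Proof. by have [_] := set_mem (valP s); apply. Qed.

Lemma zsect_ext (U : set zariski) (s r : zsect U) :
  (forall x (Ux : U x), zvalue s Ux = zvalue r Ux) -> s = r.
Proof.
move=> sr; apply: val_inj; apply/funext => y.
by rewrite !(zvalueE _ (set_mem (valP y))).
Qed.

Definition zsect_of (U : set zariski) (c : F)
    (Uc : U `<=` [set x | carrier (ring_of x) c]) : zsect U :=
  exist _ (fun=> c) (mem_set (conj (ex_intro _ c (fun=> erefl))
                                   (fun y => Uc _ (set_mem (valP y))))).

Lemma zsectE (U : set zariski) (x : zariski) (Ux : U x) :
  injective (fun s : zsect U => zvalue s Ux) /\
  [set zvalue s Ux | s in [set: zsect U]] = \bigcap_(y in U) carrier (ring_of y).
Proof.
split=> [s r sr|].
  by apply: zsect_ext => y Uy; rewrite (zvalue_cst s Uy Ux) (zvalue_cst r Uy Ux).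
apply/seteqP; split=> [_ [s _ <-] y Uy|c Uc].
  by rewrite (zvalue_cst s Ux Uy); exact: zvalueP.
by exists (zsect_of Uc).
Qed.

Lemma zsect_set0 (s r : zsect set0) : s = r.
Proof. exact: zsect_ext. Qed.

Definition zres_fun (U V : set zariski) (hVU : V `<=` U) (s : zsect U) : zsect V :=
  exist _ (fun y => zvalue s (hVU _ (set_mem (valP y))))
    (mem_set (conj
      (let: conj (ex_intro c sc) _ := set_mem (valP s) in
       ex_intro _ c (fun y => sc _))
      (fun y => zvalueP s (hVU _ (set_mem (valP y)))))).

Section Restriction.
Variables (U V : set zariski) (hVU : V `<=` U).

Lemma zres_zmod_morphism : zmod_morphism (zres_fun hVU).
Proof. by move=> s r; apply: val_inj; apply/funext. Qed.

Lemma zres_monoid_morphism : monoid_morphism (zres_fun hVU).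
Proof. by split=> [|s r]; apply: val_inj; apply/funext. Qed.

HB.instance Definition _ :=
  GRing.isZmodMorphism.Build (zsect U) (zsect V) (zres_fun hVU)
    zres_zmod_morphism.
HB.instance Definition _ :=
  GRing.isMonoidMorphism.Build (zsect U) (zsect V) (zres_fun hVU)
    zres_monoid_morphism.

Definition zres : {rmorphism zsect U -> zsect V} := zres_fun hVU.

Lemma zvalue_res (s : zsect U) (x : zariski) (Vx : V x) (Ux : U x) :
  zvalue (zres s) Vx = zvalue s Ux.
Proof. by congr (val s _); apply: val_inj. Qed.

End Restriction.

Section Germ.
Variables (U : set zariski) (x : zariski) (Ux : U x).

Definition zgerm_fun (s : zsect U) : subring_type (ring_of x) :=
  exist _ (zvalue s Ux) (mem_set (zvalueP s Ux)).

Lemma zgerm_zmod_morphism : zmod_morphism zgerm_fun.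
Proof. by move=> s r; apply: val_inj. Qed.

Lemma zgerm_monoid_morphism : monoid_morphism zgerm_fun.
Proof. by split=> [|s r]; apply: val_inj. Qed.

HB.instance Definition _ :=
  GRing.isZmodMorphism.Build (zsect U) (subring_type (ring_of x)) zgerm_fun
    zgerm_zmod_morphism.
HB.instance Definition _ :=
  GRing.isMonoidMorphism.Build (zsect U) (subring_type (ring_of x)) zgerm_fun
    zgerm_monoid_morphism.

Definition zgerm : {rmorphism zsect U -> subring_type (ring_of x)} := zgerm_fun.

End Germ.

Lemma zgerm_res (U V : set zariski) (hVU : V `<=` U) (x : zariski)
  (Ux : U x) (Vx : V x) (s : zsect U) : zgerm Vx (zres hVU s) = zgerm Ux s.
Proof. by apply: val_inj; exact: zvalue_res. Qed.

Lemma zgerm_surj (x : zariski) (a : subring_type (ring_of x)) :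
  exists (U : opens zariski) (Ux : oset U x) (s : zsect U), zgerm Ux s = a.
Proof.
have oU : open (zariski_basic [set val a]).
  exists [set [set val a]]; first by move=> _ ->; exact: finite_set1.
  by rewrite bigcup_set1.
have Ux : zariski_basic [set val a] x by move=> _ ->; exact: set_mem (valP a).
have Ua : zariski_basic [set val a] `<=` [set y | carrier (ring_of y) (val a)].
  by move=> y; apply.
by exists (Opens oU), Ux, (zsect_of Ua); apply: val_inj.
Qed.

Lemma zgerm_eq (x : zariski) (U : opens zariski) (Ux : oset U x)
  (s s' : zsect U) : zgerm Ux s = zgerm Ux s' ->
  exists (V : opens zariski) (hVU : V `<=` U),
    oset V x /\ zres hVU s = zres hVU s'.
Proof.
move=> /(congr1 val) ss'; exists U, (@subset_refl _ U); split=> //.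
by have -> : s = s' by apply: (zsectE Ux).1.
Qed.

Lemma zres_id (U : set zariski) (h : U `<=` U) (s : zsect U) : zres h s = s.
Proof. by apply: zsect_ext => x Ux; exact: zvalue_res. Qed.

Lemma zres_comp (U V W : set zariski) (hVU : V `<=` U) (hWV : W `<=` V)
  (hWU : W `<=` U) (s : zsect U) : zres hWV (zres hVU s) = zres hWU s.
Proof.
apply: zsect_ext => x Wx.
by rewrite (zvalue_res _ _ _ (hWV _ Wx)) !(zvalue_res _ _ _ (hWU _ Wx)).
Qed.

Definition model_space : ringed_space :=
  @RingedSpace zariski (fun U => zsect U) (fun U V hVU => zres hVU)
    (fun U => @zres_id U) (fun U V W => @zres_comp U V W)
    (fun x => subring_type (ring_of x)) (fun U x Ux => zgerm Ux)
    (fun U V hVU x => @zgerm_res U V hVU x) zgerm_surj zgerm_eq.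

End ZariskiSpace.

Section Models.
Variable K : fieldType.
Implicit Types D R : subring K.

Definition local_domains D : set (subring K) :=
  [set R : subring K | [/\ D `<=` R, local_ring (subring_type R)
    & forall x : K, exists a b, [/\ carrier R a, carrier R b, b != 0 & x = a / b]]].

Definition premodel D (X : set (subring K)) :=
  X !=set0 /\ X `<=` local_domains D.

(* The ring D[H x^-1]. *)
Definition quotient_ring D (H : set K) (x : K) : subring K :=
  generated_subring (D `|` [set y / x | y in H]).

Definition W_model D (H : set K) : set (subring K) :=
  \bigcup_(x in H `\ 0) localizations (quotient_ring D H x).

Definition projective_model D (X : set (subring K)) :=
  premodel D X /\
  exists H : set K, [/\ finite_set H, H `\ 0 !=set0 & X = W_model D H].

Definition ratfun : fieldType := {fraction {poly K}}.

Definition to_ratfun (c : K) : ratfun := tofrac c%:P.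

Definition poly_over R : set {poly K} := [set p | forall i, carrier R p`_i].

(* The last condition says that 1 is in the ideal of R generated by the
   coefficients of p. *)
Definition primitive R : set {poly K} :=
  [set p | poly_over R p /\ exists c : nat -> K,
     (forall i, carrier R (c i)) /\ \sum_(i < size p) c i * p`_i = 1].

Definition Nagata R : subring ratfun :=
  localization [set tofrac p | p in poly_over R]
               [set tofrac p | p in primitive R].

Definition Nagata_inter (X : set (subring K)) : subring ratfun :=
  bigcap_subring X Nagata.

Definition dominates (S : subring ratfun) R :=
  [set to_ratfun c | c in carrier R] `<=` S /\
  forall (a : subring_type R) (b : subring_type S), val b = to_ratfun (val a) ->
    (maxid _ b <-> maxid _ a).

End Models.

(* Main.v *)
(* Let H generate the model, D_x = D[H/x] for nonzero x in H, and let h be the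
   polynomial whose coefficients are the elements of H. Each x/h lies in D*, and
   the x/h generate the unit ideal of D*, so a localization S of D* contains some
   h/x, hence D_x and D_x[t]; the center of S on D_x is the required point R of
   the model. Every f in D* can be written F/G, where for each x the polynomials
   F/x^N and G/x^N are over D_x and x^N is a coefficient of G. Then x^N/G is in
   D*, so G/x^N is a unit of S. Therefore S is a localization of R[t], which makes
   it flat over R and gives that S meets K in R; the latter yields continuity.
   Conversely, R is dominated by the localization of D* at the contraction of the
   maximal ideal of R(t).

   Rings are handled inside their fraction field, a local ring being described by
   its set of units: R is a localization of A exactly when R contains A, is local,
   and consists of fractions of elements of A whose denominators are units of R. *)

Require Import Defs.
From HB Require Import structures.
From mathcomp Require Import all_boot all_order all_algebra.
From mathcomp Require Import fraction.
From mathcomp Require Import ring.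
From mathcomp Require Import boolp classical_sets functions cardinality.
From mathcomp Require Import topology.

Set Implicit Arguments.
Unset Strict Implicit.
Unset Printing Implicit Defensive.

Import GRing.Theory.

Local Open Scope classical_set_scope.
Local Open Scope ring_scope.

(** The obstacle is that an element f of [Dstar] is known only ring by ring: membership in each R(t)
    gives denominators over every D_x separately, and no common one. Homogeneity supplies it. An
    element of D[H/x] is a polynomial of some degree in the elements y/x, so a large power of x/y
    carries it into D[H/y]. Hence x^N times a polynomial over D_x behaves on all charts like a form
    of degree N in H. Such forms can be added, and a coefficient x^N makes the sum primitive once it
    is divided by x^N on the chart of x. The polynomial h is itself such a form, with N = 1.

    Domination alone does not bound the intersection of S with K from above. Its equality with R, on
    which a topology and a structure sheaf defined by membership depend, is extracted from the
    fractions over R[t].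

    Flatness concerns a tensor product given by generators and relations, where injectivity cannot
    be read off. Tensors are therefore compared with elements of M[t] localized at the polynomials
    that are units of S, where equality is tested on coefficients. *)

Section SubringFacts.
Variables (F : fieldType) (A : subring F).
Implicit Types x y : F.

Lemma carrier1 : carrier A 1.
Proof. by have [/set_mem] := subringP A. Qed.

Lemma carrierB x y : carrier A x -> carrier A y -> carrier A (x - y).
Proof.
by have [_ AB _] := subringP A => Ax Ay; apply/set_mem/AB; exact/mem_set.
Qed.

Lemma carrierM x y : carrier A x -> carrier A y -> carrier A (x * y).
Proof.
by have [_ _ AM] := subringP A => Ax Ay; apply/set_mem/AM; exact/mem_set.
Qed.

Lemma carrier0 : carrier A 0.
Proof. by rewrite -(subrr 1); apply: carrierB; exact: carrier1. Qed.

Lemma carrierN x : carrier A x -> carrier A (- x).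
Proof. by rewrite -sub0r; apply: carrierB; exact: carrier0. Qed.

Lemma carrierD x y : carrier A x -> carrier A y -> carrier A (x + y).
Proof. by move=> Ax Ay; rewrite -[y]opprK; apply: carrierB => //; exact: carrierN. Qed.

Lemma carrierX x n : carrier A x -> carrier A (x ^+ n).
Proof.
move=> Ax; elim: n => [|n IHn]; first by rewrite expr0; exact: carrier1.
by rewrite exprS; exact: carrierM.
Qed.

Lemma carrier_sum (I : Type) (r : seq I) (P : pred I) (f : I -> F) :
  (forall i, P i -> carrier A (f i)) -> carrier A (\sum_(i <- r | P i) f i).
Proof. by move=> Af; apply: big_ind => //; [exact: carrier0 | exact: carrierD]. Qed.

Lemma carrier_val (a : subring_type A) : carrier A (val a).
Proof. exact: set_mem (valP a). Qed.

Definition subr_of x (Ax : carrier A x) : subring_type A := exist _ x (mem_set Ax).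

Definition unit_in : set F := [set x | [/\ x != 0, carrier A x & carrier A x^-1]].

Lemma unit_in1 : unit_in 1.
Proof. by split; rewrite ?invr1 ?oner_neq0//; exact: carrier1. Qed.

Lemma unit_inM x y : unit_in x -> unit_in y -> unit_in (x * y).
Proof.
move=> [x0 Ax Ax'] [y0 Ay Ay']; split; rewrite ?mulf_neq0 ?invfM//; exact: carrierM.
Qed.

Lemma unit_inV x : unit_in x -> unit_in x^-1.
Proof. by move=> [x0 Ax Ax']; split; rewrite ?invr_eq0 ?invrK. Qed.

Lemma unit_inX x n : unit_in x -> unit_in (x ^+ n).
Proof.
move=> Ax; elim: n => [|n IHn]; first by rewrite expr0; exact: unit_in1.
by rewrite exprS; exact: unit_inM.
Qed.

Lemma unit_inMl x y : carrier A x -> carrier A y -> unit_in (x * y) -> unit_in x.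
Proof.
move=> Ax Ay [xy0 _ Axy']; have x0 : x != 0 by apply: contraNneq xy0 => ->; rewrite mul0r.
have y0 : y != 0 by apply: contraNneq xy0 => ->; rewrite mulr0.
by split=> //; have -> : x^-1 = y * (x * y)^-1 by [rewrite invfM mulrC mulfVK]; exact: carrierM.
Qed.

(** Locality said on elements: the nonunits are closed under addition. In a subring of a field this
    amounts to a unique maximal ideal, and it can be checked on fractions and finite sums without
    mentioning ideals. *)
Definition is_local :=
  forall x y, carrier A x -> carrier A y -> unit_in (x + y) -> unit_in x \/ unit_in y.

Lemma is_local_sum (I : Type) (r : seq I) (f : I -> F) :
  is_local -> (forall i, carrier A (f i)) -> unit_in (\sum_(i <- r) f i) ->
  exists i, unit_in (f i).
Proof.
move=> locA Af; elim: r => [|i r IHr]; first by rewrite big_nil => -[/eqP].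
rewrite big_cons => /locA [||fi|]; [exact: Af | exact: carrier_sum | by exists i|].
exact: IHr.
Qed.

Definition nonunits : set (subring_type A) := [set a | ~ unit_in (val a)].

Lemma nonunits_maximal (I : set (subring_type A)) : ideal I -> ~ I 1 -> I `<=` nonunits.
Proof.
move=> [_ _ IM] I1 a Ia [a0 Aa Aa']; apply: I1.
have -> : 1 = subr_of Aa' * a :> subring_type A by apply: val_inj; rewrite /= mulVf.
exact: IM.
Qed.

Lemma nonunits_ideal : is_local -> ideal nonunits.
Proof.
move=> locA; split=> [[/eqP//]|x y nx ny xy|a x nx ax]; last first.
- apply: nx; apply: unit_inMl (carrier_val a) _ => //; first exact: carrier_val.
  by rewrite mulrC.
- by have [] := locA _ _ (carrier_val x) (carrier_val y) xy.
Qed.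

Lemma nonunits_proper : ~ nonunits 1.
Proof. by apply; exact: unit_in1. Qed.

Lemma is_local_maximal (M : set (subring_type A)) :
  is_local -> maximal_ideal M <-> M = nonunits.
Proof.
move=> locA; have nI := nonunits_ideal locA; split=> [[MI M1 maxM]|->].
  by rewrite (maxM _ nI nonunits_proper)//; exact: nonunits_maximal.
split=> // [|J JI J1 nJ]; first exact: nonunits_proper.
by apply/seteqP; split=> //; exact: nonunits_maximal.
Qed.

Lemma is_local_local_ring : is_local -> local_ring (subring_type A).
Proof.
move=> locA; exists nonunits; split; first exact/(is_local_maximal _ locA).
by move=> M /(is_local_maximal _ locA).
Qed.

Lemma is_local_maxid : is_local -> maxid (subring_type A) = nonunits.
Proof.
move=> locA; rewrite /maxid; case: xgetP => [M _ /(is_local_maximal _ locA)//|/(_ nonunits)].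
by case; exact/(is_local_maximal _ locA).
Qed.

End SubringFacts.
Arguments carrier_val {F A} a.

(** * Primes avoiding the powers of an element *)

Section Krull.
Variables (B : comPzRingType).
Implicit Types (I J : set B) (a x : B).

Definition ideal_adjoin I x : set B := [set y | exists i b, I i /\ y = i + b * x].

Lemma ideal_adjoinP I x : ideal I -> ideal (ideal_adjoin I x).
Proof.
move=> [I0 ID IM]; split=> [|_ _ [i [b [Ii ->]]] [j [c [Ij ->]]]|a _ [i [b [Ii ->]]]].
- by exists 0, 0; rewrite mul0r addr0.
- by exists (i + j), (b + c); split; [exact: ID | rewrite mulrDl addrACA].
- by exists (a * i), (a * b); split; [exact: IM | rewrite mulrDr mulrA].
Qed.

(** An ideal P above I, maximal among those missing the powers of a, is prime: if x and y lie
    outside P, then P + Bx and P + By contain powers of a, and the product of these two powers would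
    lie in P as soon as x y does. *)
Lemma exists_prime_avoiding I a : ideal I -> (forall n, ~ I (a ^+ n)) ->
  exists P, [/\ prime_ideal P, I `<=` P & ~ P a].
Proof.
move=> II Ia; have [I0 ID IM] := II.
(* The family consists of the J for which I [|] J is a suitable ideal, instead of the suitable
   ideals themselves: Zorn's lemma for unions also takes the empty chain, whose union is empty, and
   I [|] set0 is I. *)
pose Q : set (set B) :=
  [set J | ideal (I `|` J) /\ forall n, ~ (I `|` J) (a ^+ n)].
have [G GQ totG|M [[MI Ma] Mmax]] := @Zorn_bigcup B Q.
  split; last by move=> n [/Ia//|[J GJ Jan]]; apply: (GQ _ GJ).2; right; exact: Jan.
  split; first by left.
  - move=> x y [Ix|[J GJ Jx]] [Iy|[J' GJ' Jy]]; first by left; exact: ID.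
    + have [[_ /(_ x y) + _] _] := GQ _ GJ'.
      by case=> [||Ixy|J'xy]; [left|right|left|right; exists J'].
    + have [[_ /(_ x y) + _] _] := GQ _ GJ.
      by case=> [||Ixy|J'xy]; [right|left|left|right; exists J].
    + have [JJ'|J'J] := totG _ _ GJ GJ'.
        have [[_ /(_ x y) + _] _] := GQ _ GJ'.
        by case=> [||Ixy|J'xy]; [right; exact: JJ'|right|left|right; exists J'].
      have [[_ /(_ x y) + _] _] := GQ _ GJ.
      by case=> [||Ixy|J'xy]; [right|right; exact: J'J|left|right; exists J].
  - move=> b x [Ix|[J GJ Jx]]; first by left; exact: IM.
    have [[_ _ /(_ b x) +] _] := GQ _ GJ.
    by case=> [|Ixy|J'xy]; [right|left|right; exists J].
set P := I `|` M in MI Ma; have [P0 PD PM] := MI.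
have Pmax J : ideal J -> P `<=` J -> (forall n, ~ J (a ^+ n)) -> J `<=` P.
  move=> JI PJ Ja; apply: contrapT => nJP; apply: (Mmax J).
    split=> [x Mx|JM]; first by apply: PJ; right.
    by apply: nJP => x /JM Mx; right.
  have IJ : I `|` J = J by apply/setUidPr => x Ix; apply: PJ; left.
  by split; rewrite IJ.
have Padj x : ~ P x -> exists n i b, P i /\ a ^+ n = i + b * x.
  move=> Px; apply: contrapT => nadj; apply: Px.
  apply: (Pmax _ (ideal_adjoinP x MI)).
  - by move=> y Py; exists y, 0; rewrite mul0r addr0.
  - by move=> n [i [b ib]]; apply: nadj; exists n, i, b.
  - by exists 0, 1; rewrite mul1r add0r.
exists P; split; last by have := Ma 1; rewrite expr1.
- split=> // [|x y Pxy]; first by have := Ma 0; rewrite expr0.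
  apply: contrapT => /not_orP [/Padj [n [i [b [Pi an]]]] /Padj [m [j [c [Pj am]]]]].
  apply: (Ma (n + m)); rewrite exprD an am.
  have -> : (i + b * x) * (j + c * y) = (j + c * y) * i + b * x * j + b * c * (x * y).
    by ring.
  by apply: (PD); [apply: PD; exact: PM | exact: PM].
- by move=> x Ix; left.
Qed.

End Krull.

Lemma subring_ext (F : fieldType) (A B : subring F) :
  carrier A `<=` carrier B -> carrier B `<=` carrier A -> A = B.
Proof.
case: A B => [a ha] [b hb] /= ab ba; have ab' : a = b by apply/seteqP.
by case: b / ab' hb {ab ba} => hb; congr Subring; exact: Prop_irrelevance.
Qed.

(** * Localizations of a subring, described by their units *)

Section Localized.
Variable F : fieldType.
Implicit Types (A B R S : subring F).

Definition localized A R :=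
  [/\ carrier A `<=` carrier R, is_local R
    & forall c, carrier R c -> exists a s,
        [/\ carrier A a, carrier A s, unit_in R s & c = a / s]].

Lemma localized_sub A R : localized A R -> carrier A `<=` carrier R.
Proof. by case. Qed.

Lemma localized_local A R : localized A R -> is_local R.
Proof. by case. Qed.

Lemma localized_subset A R S : localized A R -> carrier A `<=` carrier S ->
  (forall a, carrier A a -> unit_in R a -> unit_in S a) ->
  carrier R `<=` carrier S.
Proof.
move=> [_ _ AR] AS RS c /AR [a [s [Aa As Rs ->]]]; apply: carrierM; first exact: AS.
by have [] := RS _ As Rs.
Qed.

Lemma localized_inj A R S : localized A R -> localized A S ->
  (forall a, carrier A a -> unit_in R a <-> unit_in S a) -> R = S.
Proof.
move=> AR AS RS; apply: subring_ext.
  by apply: (localized_subset AR (localized_sub AS)) => a /RS [].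
by apply: (localized_subset AS (localized_sub AR)) => a /RS [].
Qed.

Section AtPrime.
Variables (A : subring F) (P : set (subring_type A)).
Hypothesis primeP : prime_ideal P.
Let S : set F := [set val x | x in ~` P].

Lemma prime_compl1 : S 1.
Proof. by have [_ P1 _] := primeP; exists 1. Qed.

Lemma prime_compl_neq0 s : S s -> s != 0.
Proof.
have [[P0 _ _] _ _] := primeP => -[x nPx <-]; apply/eqP => x0; apply: nPx.
by have -> : x = 0 by exact: val_inj.
Qed.

Lemma prime_localizationE :
  carrier (localization A S) = [set a / s | a in carrier A & s in S].
Proof.
have [_ _ PM] := primeP; apply: localizationE.
- exact: prime_compl1.
- move=> _ _ [x nPx <-] [y nPy <-]; exists (x * y) => //.
  by move=> /PM [/nPx|/nPy].
- by move=> /prime_compl_neq0 /eqP.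
- by move=> _ [x _ <-]; exact: carrier_val.
Qed.

Lemma prime_localization_unit (a : subring_type A) :
  unit_in (localization A S) (val a) <-> ~ P a.
Proof.
have [[_ _ PI] _ PM] := primeP; split=> [[a0 _] + Pa|nPa].
  rewrite prime_localizationE => -[b Ab [_ [s nPs <-] ab]].
  have s0 : val s != 0 by apply: prime_compl_neq0; exists s.
  apply: nPs; suff -> : s = subr_of Ab * a by exact: PI.
  apply: val_inj => /=; have : b / val s * val s = (val a)^-1 * val s by rewrite ab.
  by rewrite mulfVK// => ->; rewrite mulrAC mulVf// mul1r.
have Sa : S (val a) by exists a.
split; first exact: prime_compl_neq0.
  rewrite prime_localizationE; exists (val a); first exact: carrier_val.
  by exists 1; [exact: prime_compl1 | rewrite divr1].
rewrite prime_localizationE; exists 1; first exact: carrier1.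
by exists (val a); rewrite ?div1r.
Qed.

Lemma prime_localization_localized : localized A (localization A S).
Proof.
have [[P0 PD PI] P1 PM] := primeP; set R := localization A S.
have AR : carrier A `<=` carrier R.
  move=> a Aa; rewrite prime_localizationE; exists a => //.
  by exists 1; [exact: prime_compl1 | rewrite divr1].
have Rfrac c : carrier R c -> exists a s : subring_type A, ~ P s /\ c = val a / val s.
  rewrite prime_localizationE => -[a Aa [_ [s nPs <-] <-]].
  by exists (subr_of Aa), s.
split=> // [x y|c /Rfrac [a [s [nPs ->]]]]; last first.
  exists (val a), (val s); split=> //; try exact: carrier_val.
  exact/prime_localization_unit.
move=> /Rfrac [a [s [nPs ->]]] /Rfrac [b [r [nPr ->]]].
have Rs : unit_in R (val s) by exact/prime_localization_unit.
have Rr : unit_in R (val r) by exact/prime_localization_unit.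
have [s0 _ _] := Rs; have [r0 _ _] := Rr; rewrite addf_div// => Rab.
have {Rab} : unit_in R (val (a * r + b * s)).
  have -> : val (a * r + b * s) = (val a * val r + val b * val s) / (val s * val r) * (val s * val r).
    by rewrite mulfVK// mulf_neq0.
  by apply: unit_inM => //; exact: unit_inM.
move=> /prime_localization_unit nP.
have nPab : ~ P a \/ ~ P b.
  apply: contrapT => /not_orP [/contrapT Pa /contrapT Pb]; apply: nP.
  by apply: PD; rewrite mulrC; exact: PI.
case: nPab => nPx; [left|right]; apply: unit_inM; try exact: unit_inV.
  exact/prime_localization_unit.
exact/prime_localization_unit.
Qed.

End AtPrime.

Lemma nonunits_prime A R : carrier A `<=` carrier R -> is_local R ->
  prime_ideal [set a : subring_type A | ~ unit_in R (val a)].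
Proof.
move=> AR locR; have Rv (a : subring_type A) : carrier R (val a) by apply/AR; exact: carrier_val.
split=> /= [|/(_ (unit_in1 R))//|x y nxy].
  split=> /= [[/eqP//]|x y nx ny xy|a x nx ax].
    by have [] := locR _ _ (Rv x) (Rv y) xy.
  by apply: nx; apply: unit_inMl (Rv x) (Rv a) _; rewrite mulrC.
apply: contrapT => /not_orP [/contrapT Rx /contrapT Ry]; apply: nxy.
exact: unit_inM.
Qed.

(** The prime is recovered from R as the set of elements of A that are not units of R. *)
Lemma localizationsP A R : localizations A R <-> localized A R.
Proof.
split=> [[P [primeP ->]]|AR]; first exact: prime_localization_localized.
exists [set a | ~ unit_in R (val a)].
have pP := nonunits_prime (localized_sub AR) (localized_local AR).
split=> //; apply: (localized_inj AR (prime_localization_localized pP)) => a Aa.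
split=> [Ra|/(prime_localization_unit pP (subr_of Aa)) /contrapT//].
by apply/(prime_localization_unit pP (subr_of Aa)) => /(_ Ra).
Qed.

(** The localization at the zero ideal; it provides the generic point through which sections are
    glued. *)
Lemma exists_fraction_field A : exists2 R, localized A R &
  forall a, carrier A a -> a != 0 -> unit_in R a.
Proof.
have pP : prime_ideal [set a : subring_type A | val a = 0].
  split=> /= [|/eqP|x y /eqP]; rewrite ?oner_eq0//.
    by split=> //= [x y -> ->|a x ->]; rewrite ?addr0 ?mulr0.
  by rewrite mulf_eq0 => /orP [/eqP|/eqP]; [left|right].
eexists; first exact: prime_localization_localized pP.
move=> a Aa a0.
by apply/(prime_localization_unit pP (subr_of Aa))/eqP.
Qed.

Lemma fraction_field_max A R S : localized A R ->
  (forall a, carrier A a -> a != 0 -> unit_in R a) -> localized A S ->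
  carrier S `<=` carrier R.
Proof.
move=> AR Runit AS; apply: (localized_subset AS (localized_sub AR)) => a Aa [a0 _ _].
exact: Runit.
Qed.

Definition ideal_of A (I : set F) :=
  [/\ I `<=` carrier A, I 0, forall x y, I x -> I y -> I (x + y)
    & forall a x, carrier A a -> I x -> I (a * x)].

(** Applied by contradiction, as a local test: if I contains a unit of every localization of A in
    which a is a unit, then some power of a lies in I. With a = 1 it tests whether I is all of A. *)
Lemma exists_localized_avoiding A (I : set F) a : ideal_of A I -> carrier A a ->
  (forall n, ~ I (a ^+ n)) ->
  exists R, [/\ localized A R, unit_in R a & forall d, I d -> ~ unit_in R d].
Proof.
move=> [IA I0 ID IM] Aa Ian.
have II : ideal [set x : subring_type A | I (val x)].
  by split=> //= [x y|b x]; [exact: ID | apply: IM; exact: carrier_val].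
have [|P [primeP IP nPa]] := @exists_prime_avoiding _ _ (subr_of Aa) II.
  move=> n /=; have -> : val (subr_of Aa ^+ n) = a ^+ n; last exact: Ian.
  elim: n => [|n IHn]; first by rewrite !expr0.
  by rewrite !exprS -IHn.
exists (localization A [set val x | x in ~` P]).
split; first exact: prime_localization_localized.
- exact/(prime_localization_unit primeP (subr_of Aa)).
- move=> d Id /(prime_localization_unit primeP (subr_of (IA _ Id))); apply.
  exact: IP.
Qed.

Lemma localized_denom A R (H : set F) : localized A R -> finite_set H ->
  H `<=` carrier R ->
  exists s, [/\ carrier A s, unit_in R s & forall h, H h -> carrier A (s * h)].
Proof.
move=> [AR locR fr] /finite_seqP [r ->]; elim: r => [|h r IHr] HR.
  by exists 1; split; [exact: carrier1 | exact: unit_in1 | ].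
have [|s [As Rs sr]] := IHr.
  by move=> x /= xr; apply: HR; rewrite /= inE xr orbT.
have [|a [t [Aa At Rt hat]]] := fr h; first by apply: HR; rewrite /= inE eqxx.
have [t0 _ _] := Rt; exists (s * t); split; [exact: carrierM | exact: unit_inM |].
move=> x /=; rewrite inE => /orP [/eqP ->|/sr Asx].
  by rewrite hat -mulrA (mulrC t) divfK//; exact: carrierM.
by rewrite mulrAC; exact: carrierM.
Qed.

End Localized.

Section Dominated.
Variables (F L : fieldType) (i : {rmorphism F -> L}).
Implicit Types (A R : subring F) (T : subring L).

(** Only one implication on units is required, since a ring morphism preserves units. The map i is
    arbitrary so that centers can be taken along K -> K(t) and also inside K(t). *)
Definition dominated R T :=
  (forall c, carrier R c -> carrier T (i c)) /\
  (forall c, carrier R c -> unit_in T (i c) -> unit_in R c).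

Lemma unit_in_morph R T c : (forall c, carrier R c -> carrier T (i c)) ->
  unit_in R c -> unit_in T (i c).
Proof. by move=> RT [c0 Rc Rc']; split; rewrite ?fmorph_eq0 -?fmorphV//; exact: RT. Qed.

(** An element of A is a unit of R, or of R', exactly when its image is a unit of T, and these units
    determine a localization of A. *)
Lemma dominated_uniq A R R' T : localized A R -> localized A R' ->
  dominated R T -> dominated R' T -> R = R'.
Proof.
move=> AR AR' [RT Rdom] [RT' Rdom']; apply: (localized_inj AR AR') => a Aa.
split=> [Ra|Ra'].
  by apply: Rdom'; [exact: localized_sub AR' _ Aa | exact: unit_in_morph Ra].
by apply: Rdom; [exact: localized_sub AR _ Aa | exact: unit_in_morph Ra'].
Qed.

(** R is the localization of A at the contraction of the nonunits of T. *)
Lemma exists_center A T : is_local T -> (forall a, carrier A a -> carrier T (i a)) ->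
  exists2 R, localized A R & dominated R T.
Proof.
move=> locT AT; pose P := [set a : subring_type A | ~ unit_in T (i (val a))].
have Tv (a : subring_type A) : carrier T (i (val a)) by apply/AT; exact: carrier_val.
have pP : prime_ideal P.
  split=> /= [|/(_ _) h1|x y nxy].
  - split=> /= [[]|x y nx ny|a x nx ax]; first by rewrite /= rmorph0 eqxx.
      move=> xy; have {xy} : unit_in T (i (val x + val y)) := xy.
      by rewrite rmorphD => xy; have [] := locT _ _ (Tv x) (Tv y) xy.
    have {ax} : unit_in T (i (val a * val x)) := ax.
    rewrite mulrC rmorphM => ax; apply: nx.
    exact: unit_inMl (Tv x) (Tv a) ax.
  - by apply: h1; rewrite /= rmorph1; exact: unit_in1.
  - apply: contrapT => /not_orP [/contrapT Rx /contrapT Ry]; apply: nxy.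
    suff : unit_in T (i (val x * val y)) by [].
    by rewrite rmorphM; exact: unit_inM.
have AR := prime_localization_localized pP.
set R := localization _ _ in AR; exists R => //.
have unitR a : carrier A a -> unit_in R a <-> unit_in T (i a).
  move=> Aa; have [h1 h2] := prime_localization_unit pP (subr_of Aa).
  by split=> [/h1 /contrapT//|Ta]; apply: h2; apply.
have fr c : carrier R c -> exists a s, [/\ carrier A a, carrier A s, unit_in R s & c = a / s].
  by case: AR => _ _; apply.
split=> c /fr [a [s [Aa As Rs ->]]]; rewrite rmorphM fmorphV.
  by apply: carrierM; [exact: AT | have /(unitR _ As) [] := Rs].
have /(unitR _ As) Ts := Rs; have [s0 _ _] := Ts => Tas.
apply: unit_inM (unit_inV Rs); apply/(unitR _ Aa).
by rewrite -(divfK s0 (i a)); exact: unit_inM.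
Qed.

End Dominated.

(** * The space of a set of local rings: sheaf axiom and affine charts *)

Section ModelSpace.
Variables (F : fieldType) (X : set (subring F)).
Implicit Types (x y : zariski X).

Lemma ring_of_inj : injective (@ring_of F X).
Proof. exact: val_inj. Qed.

Lemma ring_ofP x : X (ring_of x).
Proof. exact: set_mem (valP x). Qed.

Definition zpoint R (XR : X R) : zariski X := exist _ R (mem_set XR).

Lemma zariski_openP (U : set (zariski X)) : open U <->
  forall x, U x -> exists H, [/\ finite_set H, zariski_basic H x & zariski_basic H `<=` U].
Proof.
split=> [[G Gfin <-] x [H GH Hx]|UH].
  exists H; split=> //; first exact: Gfin.
  by move=> y Hy; exists H.
exists [set H | finite_set H /\ @zariski_basic F X H `<=` U]; first by move=> H [].
apply/seteqP; split=> [x [H [_ HU] /HU//]|x /UH [H [fH Hx HU]]].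
by exists H.
Qed.

Lemma zariski_basic_open (H : set F) : finite_set H -> open (@zariski_basic F X H).
Proof. by move=> fH; apply/zariski_openP => x Hx; exists H; split. Qed.

Section Generic.
Variable eta : zariski X.
Hypothesis generic : forall x, carrier (ring_of x) `<=` carrier (ring_of eta).

Lemma generic_in_open (U : set (zariski X)) x : open U -> U x -> U eta.
Proof.
move=> /zariski_openP UH /UH [H [_ Hx HU]]; apply: HU => h /Hx.
exact: generic.
Qed.

(** Every nonempty open set contains [eta], so any two nonempty members of the cover meet there and
    compatible sections share one value in F; that value is the glued section. If [eta] is not in U,
    then U is empty and its ring of sections is zero. *)
Lemma model_space_sheaf : is_sheaf (model_space X).
Proof.
move=> I U W WU UW s compat.
have [Ueta|nUeta] := pselect (oset U eta); last first.
  have U0 x : ~ oset U x by move=> Ux; apply: nUeta; exact: generic_in_open (osetP U) Ux.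
  have UE : oset U `<=` [set x | carrier (ring_of x) 0] by move=> x /U0.
  by exists (zsect_of UE); split=> [i|t _]; apply: zsect_ext => x Ux; case: (U0 x) => //;
    exact: WU Ux.
have [i0 _ Wi0] := UW _ Ueta.
have sE j x (Wjx : oset (W j) x) : zvalue (s j) Wjx = zvalue (s i0) Wi0.
  have Wj : oset (W j) eta by exact: generic_in_open (osetP (W j)) Wjx.
  rewrite (zvalue_cst _ Wjx Wj).
  have oV : open (oset (W i0) `&` oset (W j)) by apply: openI; exact: osetP.
  have := compat i0 j (Opens oV) (@subIsetl _ _ _) (@subIsetr _ _ _).
  have Veta : (oset (W i0) `&` oset (W j)) eta by [].
  move=> /(congr1 (fun r => zvalue r Veta)).
  by rewrite (zvalue_res _ _ _ Wi0) (zvalue_res _ _ _ Wj).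
have UE : oset U `<=` [set x | carrier (ring_of x) (zvalue (s i0) Wi0)].
  by move=> x /UW [j _ Wjx]; rewrite /= -(sE j x Wjx); exact: zvalueP.
exists (zsect_of UE); split=> [i|t tE].
  by apply: zsect_ext => x Wix; rewrite (zvalue_res _ _ _ (WU i _ Wix)) sE.
apply: zsect_ext => x Ux; have [j _ Wjx] := UW _ Ux.
by rewrite (zvalue_cst t Ux (WU j _ Wjx)) -(zvalue_res (WU j) t Wjx) tE sE.
Qed.

End Generic.

Lemma model_space_locally_ringed : (forall R, X R -> is_local R) ->
  locally_ringed (model_space X).
Proof. by move=> locX x; apply/is_local_local_ring/locX; exact: ring_ofP. Qed.

Section Chart.
Variables (A : subring F) (U : opens (zariski X)).
Hypothesis UP : forall x, oset U x <-> localized A (ring_of x).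
Hypothesis AX : forall R, localized A R -> X R.

Lemma chart_sub (a : subring_type A) :
  oset U `<=` [set x | carrier (ring_of x) (val a)].
Proof. by move=> x /UP [AR _ _]; apply: AR; exact: carrier_val. Qed.

Definition chart_map (a : subring_type A) : zsect U := zsect_of (chart_sub a).

Lemma chart_zmod_morphism : zmod_morphism chart_map.
Proof. by move=> a b; exact: zsect_ext. Qed.

Lemma chart_monoid_morphism : monoid_morphism chart_map.
Proof. by split=> [|a b]; exact: zsect_ext. Qed.

HB.instance Definition _ :=
  GRing.isZmodMorphism.Build (subring_type A) (zsect U) chart_map
    chart_zmod_morphism.
HB.instance Definition _ :=
  GRing.isMonoidMorphism.Build (subring_type A) (zsect U) chart_map
    chart_monoid_morphism.

Definition chart : {rmorphism subring_type A -> zsect U} := chart_map.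

Let pp (x : model_space X) := @point_prime (model_space X) U _ chart x.
Let bo a := @basic_open (model_space X) U _ chart a.

Lemma chart_point_prime x : oset U x ->
  pp x = [set a | ~ unit_in (ring_of x) (val a)].
Proof.
move=> Ux; have /UP [_ locR _] := Ux; apply/seteqP; split=> a.
  by move=> /(_ Ux); rewrite /= is_local_maxid.
by move=> na Ux'; rewrite /= is_local_maxid.
Qed.

Lemma chart_basic_open a : bo a = [set x | oset U x /\ unit_in (ring_of x) (val a)].
Proof.
apply/seteqP; split=> x [Ux]; have ppE := chart_point_prime Ux.
  by move=> npa; split=> //; apply: contrapT => nRa; apply: npa; rewrite -/(pp x) ppE.
by move=> Ra; split=> //; rewrite -/(pp x) ppE; apply.
Qed.

Lemma chart_inverse a (V : opens (zariski X)) (VU : oset V `<=` oset U) :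
  oset V = bo a -> exists v, zres VU (chart a) * v = 1.
Proof.
move=> VE; have Va : oset V `<=` [set x | carrier (ring_of x) (val a)^-1].
  by move=> x; rewrite VE chart_basic_open => -[_ []].
exists (zsect_of Va); apply: zsect_ext => x Vx.
have : oset V x by [].
rewrite {1}VE chart_basic_open => -[_ [a0 _ _]].
exact: mulfV.
Qed.

(** The value c of s has a conductor, the ideal of the d in A with d c in A. At each point of V, c
    is a fraction over A, so the conductor contains a unit there; hence it contains a power of a. *)
Lemma chart_sections a (V : opens (zariski X)) (VU : oset V `<=` oset U) :
  oset V = bo a -> forall s : zsect V, exists (b : subring_type A) n,
    s * zres VU (chart a) ^+ n = zres VU (chart b).
Proof.
move=> VE s; have zX (r : zsect V) n x (Vx : oset V x) : zvalue (r ^+ n) Vx = zvalue r Vx ^+ n.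
  by elim: n => [|n IHn]; rewrite ?expr0// !exprS -IHn.
(* Over an empty V the ring of sections is zero and any b and n will do. *)
have [[x Vx]|V0] := pselect (exists x, oset V x); last first.
  by exists 0, 0%N; apply: zsect_ext => x Vx; case: V0; exists x.
pose c := zvalue s Vx; pose I := [set d | carrier A d /\ carrier A (d * c)].
have II : ideal_of A I.
  split=> [d []//||d e [Ad Adc] [Ae Aec]|b d Ab [Ad Adc]].
  - by split; rewrite ?mul0r; exact: carrier0.
  - by split; rewrite ?mulrDl; exact: carrierD.
  - by split; rewrite -?mulrA; exact: carrierM.
have [n [Aan Aanc]] : exists n, I (val a ^+ n).
  apply: contrapT => /forallNP nI.
  have [R [AR Ra RI]] := exists_localized_avoiding II (carrier_val a) nI.
  pose y := zpoint (AX AR).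
  have Vy : oset V y by rewrite VE chart_basic_open; split=> //; apply/UP.
  have := zvalueP s Vy; rewrite (zvalue_cst s Vy Vx) -/c => Rc.
  have [_ _ /(_ _ Rc) [b [d [Ab Ad Rd cE]]]] := AR; apply: (RI d _ Rd).
  by have [d0 _ _] := Rd; split=> //; rewrite cE mulrC divfK.
exists (subr_of Aanc), n; apply: zsect_ext => y Vy.
rewrite [LHS]/(zvalue s Vy * zvalue (zres VU (chart a) ^+ n) Vy) zX (zvalue_cst s Vy Vx).
by rewrite -/c; exact: mulrC.
Qed.

(** If a is not 0, no power of a is 0, so V has a point, where the value of the section of b is b
    itself: b = 0 and n = 0 suffices. If a = 0, then V is empty, b is arbitrary, and n = 1 is
    needed. *)
Lemma chart_torsion_free a (V : opens (zariski X)) (VU : oset V `<=` oset U) :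
  oset V = bo a -> forall b : subring_type A, zres VU (chart b) = 0 ->
    exists n, a ^+ n * b = 0.
Proof.
move=> VE b b0; have [->|a0] := eqVneq a 0; first by exists 1%N; rewrite expr1 mul0r.
have II : ideal_of A [set 0].
  split=> [_ ->||x y -> ->|c x _ ->]; rewrite /= ?addr0 ?mulr0//.
  exact: carrier0.
have [n /= /eqP|R [AR Ra _]] := exists_localized_avoiding II (carrier_val a).
  by rewrite expf_eq0 => /andP [_ /eqP va0]; move/eqP: a0; apply; exact: val_inj.
have Vx : oset V (zpoint (AX AR)) by rewrite VE chart_basic_open; split=> //; apply/UP.
exists 0%N; rewrite expr0 mul1r; apply: val_inj.
by have := congr1 (fun s => zvalue s Vx) b0.
Qed.

Lemma chart_is_spec : @is_spec_via (model_space X) U _ chart.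
Proof.
split; last by move=> a V VU VE; split; [exact: chart_inverse VE
  | exact: chart_sections VE | exact: chart_torsion_free VE].
- split=> [x Ux|x y /set_mem Ux /set_mem Uy|P primeP].
  + suff : prime_ideal (pp x) by []; rewrite (chart_point_prime Ux).
    by have /UP [AR locR _] := Ux; exact: nonunits_prime.
  + rewrite [LHS](chart_point_prime Ux) [RHS](chart_point_prime Uy) => /seteqP [xy yx].
    apply: ring_of_inj; have /UP ARx := Ux; have /UP ARy := Uy.
    apply: (localized_inj ARx ARy) => a Aa.
    split=> Ra; apply: contrapT; first by move=> /(yx (subr_of Aa)) /(_ Ra).
    by move=> /(xy (subr_of Aa)) /(_ Ra).
  + have AR := prime_localization_localized primeP.
    have Ux : oset U (zpoint (AX AR)) by exact/UP.
    exists (zpoint (AX AR)) => //; rewrite [LHS](chart_point_prime Ux).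
    apply/seteqP; split=> a /=.
      by move=> nu; apply: contrapT => /(prime_localization_unit primeP).
    by move=> Pa /(prime_localization_unit primeP) /(_ Pa).
- move=> V VU; split=> [oV x Vx|VB].
    (* A common denominator s of H at x gives the neighborhood D(s): wherever s is a unit, each h =
       (s h) / s belongs to the ring. *)
    have /zariski_openP /(_ _ Vx) [H [fH Hx HV]] := oV.
    have /UP ARx := VU _ Vx; have [s [As Rs sH]] := localized_denom ARx fH Hx.
    exists (subr_of As); split.
      by rewrite -[X in X x]/(bo (subr_of As)) chart_basic_open; split; [exact: VU|].
    move=> y; rewrite -[X in X y]/(bo (subr_of As)) chart_basic_open => -[/UP ARy [s0 _ Rys]].
    apply: HV => h Hh; rewrite -(mulKf s0 h); apply: carrierM => //.
    by have [AR _ _] := ARy; apply: AR; exact: sH.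
  apply/zariski_openP => x /VB [a [+ bV]].
  rewrite -[X in X x]/(bo a) chart_basic_open => -[Ux [a0 Ra Ra']].
  have /zariski_openP /(_ _ Ux) [H [fH Hx HU]] := osetP U.
  (* Inside U, where a already lies in every ring, being a unit at a point means that a^-1 belongs
     to the ring; so D(a) is open. *)
  exists (H `|` [set (val a)^-1]); split.
  + by rewrite finite_setU.
  + by move=> h [/Hx//| ->].
  + move=> y Hy; apply: bV; rewrite -[X in X y]/(bo a) chart_basic_open.
    have Uy : oset U y by apply: HU => h Hh; apply: Hy; left.
    have /UP [AR _ _] := Uy; split=> //; split=> //; first exact/AR/carrier_val.
    by apply: Hy; right.
Qed.

End Chart.

End ModelSpace.

Lemma localizations_is_Spec (F : fieldType) (A : subring F) :
  is_Spec (subring_type A) (model_space (localizations A)).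
Proof.
have UP x : oset (opens_setT (zariski (localizations A))) x <-> localized A (ring_of x).
  by split=> // _; apply/localizationsP; exact: ring_ofP.
have AX R : localized A R -> localizations A R by move=> /localizationsP.
split; last by exists (chart UP); exact: chart_is_spec.
- have [R AR Rgen] := exists_fraction_field A.
  apply: (@model_space_sheaf _ _ (zpoint (AX _ AR))) => x.
  apply: (fraction_field_max AR Rgen).
  by apply/localizationsP; exact: ring_ofP.
- by apply: model_space_locally_ringed => R /localizationsP [].
Qed.

Lemma is_Spec_scheme (A : comPzRingType) (X : ringed_space) : is_Spec A X -> is_scheme X.
Proof. by move=> [shX lrX [phi phiP]]; split=> // x; exists (opens_setT X), A, phi. Qed.

(** * Morphisms of such spaces given by contraction *)

Section ModelMorphism.
Variables (F L : fieldType) (i : {rmorphism F -> L}).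
Variables (X : set (subring F)) (Y : set (subring L)).
Variable f : zariski Y -> zariski X.
Hypothesis fE : forall y c, carrier (ring_of (f y)) c <-> carrier (ring_of y) (i c).

(** Both directions of [fE] are used: they make the preimage of the basic set of H equal to the
    basic set of the image of H. *)
Lemma model_fun_continuous : continuous f.
Proof.
apply/continuousP => V /zariski_openP VH; apply/zariski_openP => y /VH [H [fH Hy HV]].
exists [set i h | h in H]; split; first exact: finite_image.
  by move=> _ [h /Hy/fE ? <-].
by move=> z Hz; apply: HV => h Hh; apply/fE/Hz; exists h.
Qed.

Let preim (V : set (zariski X)) : set (zariski Y) := f @^-1` V.

Definition model_sect_value (V : set (zariski X)) (s : zsect V) (y : set_type (preim V)) : L :=
  i (zvalue s (set_mem (valP y) : V (f (set_val y)))).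

Lemma model_sect_valueP (V : set (zariski X)) (s : zsect V) :
  model_sect_value s \in @zsect_set L Y (preim V).
Proof.
apply/mem_set; split=> [|y]; last exact/fE/zvalueP.
have [[c sc] _] := set_mem (valP s).
by exists (i c) => y; congr (i _); exact: sc.
Qed.

Definition model_sect_fun (V : set (zariski X)) (s : zsect V) : zsect (preim V) :=
  exist _ (model_sect_value s) (model_sect_valueP s).

Lemma zvalue_model_sect (V : set (zariski X)) (s : zsect V) y
  (Vy : preim V y) (Vfy : V (f y)) : zvalue (model_sect_fun s) Vy = i (zvalue s Vfy).
Proof. by rewrite {1}/zvalue /=; congr (i _); congr (val s _); exact: val_inj. Qed.

Section Sections.
Variable V : set (zariski X).

Lemma model_sect_zmod_morphism : zmod_morphism (@model_sect_fun V).
Proof. by move=> s r; apply: val_inj; apply/funext => y; exact: rmorphB. Qed.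

Lemma model_sect_monoid_morphism : monoid_morphism (@model_sect_fun V).
Proof.
split=> [|s r]; apply: val_inj; apply/funext => y; first exact: rmorph1.
exact: rmorphM.
Qed.

HB.instance Definition _ :=
  GRing.isZmodMorphism.Build (zsect V) (zsect (preim V)) (@model_sect_fun V)
    model_sect_zmod_morphism.
HB.instance Definition _ :=
  GRing.isMonoidMorphism.Build (zsect V) (zsect (preim V)) (@model_sect_fun V)
    model_sect_monoid_morphism.

Definition model_sect : {rmorphism zsect V -> zsect (preim V)} := @model_sect_fun V.

End Sections.

Section Stalks.
Variable y : zariski Y.

Definition model_stalk_fun (c : subring_type (ring_of (f y))) :
  subring_type (ring_of y) := subr_of ((fE y (val c)).1 (carrier_val c)).

Lemma model_stalk_zmod_morphism : zmod_morphism model_stalk_fun.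
Proof. by move=> s r; apply: val_inj; exact: rmorphB. Qed.

Lemma model_stalk_monoid_morphism : monoid_morphism model_stalk_fun.
Proof. by split=> [|s r]; apply: val_inj; [exact: rmorph1 | exact: rmorphM]. Qed.

HB.instance Definition _ :=
  GRing.isZmodMorphism.Build _ _ model_stalk_fun model_stalk_zmod_morphism.
HB.instance Definition _ :=
  GRing.isMonoidMorphism.Build _ _ model_stalk_fun model_stalk_monoid_morphism.

Definition model_stalk :
  {rmorphism subring_type (ring_of (f y)) -> subring_type (ring_of y)} := model_stalk_fun.

End Stalks.

Lemma model_sect_res (V W : opens (zariski X)) (WV : oset W `<=` oset V)
  (h : opens_preim model_fun_continuous W `<=` opens_preim model_fun_continuous V)
  (s : zsect V) : model_sect W (zres WV s) = zres h (model_sect V s).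
Proof.
apply: zsect_ext => y Wy; have Vfy : oset V (f y) by exact: WV.
have Wfy : oset W (f y) by exact: Wy.
rewrite (zvalue_model_sect _ _ Wfy) (zvalue_res _ _ _ Vfy) (zvalue_res _ _ _ (h _ Wy)).
by rewrite (zvalue_model_sect _ _ Vfy).
Qed.

Lemma model_stalk_germ (V : opens (zariski X)) y (Vfy : oset V (f y))
  (Vy : oset (opens_preim model_fun_continuous V) y) (s : zsect V) :
  model_stalk y (zgerm Vfy s) = zgerm Vy (model_sect V s).
Proof. by apply: val_inj; rewrite /= (zvalue_model_sect _ _ Vfy). Qed.

Definition model_morphism : ringed_morphism (model_space Y) (model_space X) :=
  @RingedMorphism (model_space Y) (model_space X) f model_fun_continuous
    model_sect model_sect_res model_stalk model_stalk_germ.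

End ModelMorphism.

HB.instance Definition _ (K : fieldType) :=
  GRing.RMorphism.copy (@to_ratfun K) (@tofrac {poly K} \o polyC).

Lemma mulr_of_inv (F : fieldType) (a b s : F) :
  a != 0 -> s != 0 -> a^-1 = b / s -> a * b = s.
Proof. by move=> a0 s0 /(congr1 (fun z => a * z * s)); rewrite mulfV// mul1r mulrA divfK. Qed.

Lemma unit_in_addf (F : fieldType) (A : subring F) (a b q s : F) :
  unit_in A q -> unit_in A s -> unit_in A (a / q + b / s) -> unit_in A (a * s + b * q).
Proof.
move=> Uq Us; have [[q0 _ _] [s0 _ _]] := (Uq, Us).
have -> : a * s + b * q = (a / q + b / s) * (q * s).
  by rewrite mulrDl mulrA divfK// [q * s]mulrC mulrA divfK.
by move=> U; apply: unit_inM => //; exact: unit_inM.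
Qed.

(** * Primitive polynomials and the Nagata ring of a local ring *)

Section PolyOver.
Variables (K : fieldType) (R : subring K).
Implicit Types p q : {poly K}.

Lemma poly_over0 : poly_over R 0.
Proof. by move=> k; rewrite coef0; exact: carrier0. Qed.

Lemma poly_overC c : carrier R c -> poly_over R c%:P.
Proof. by move=> Rc k; rewrite coefC; case: ifP => // _; exact: carrier0. Qed.

Lemma poly_overXn n : poly_over R 'X^n.
Proof. by move=> k; rewrite coefXn; case: eqP => _; [exact: carrier1 | exact: carrier0]. Qed.

Lemma poly_overD p q : poly_over R p -> poly_over R q -> poly_over R (p + q).
Proof. by move=> Rp Rq k; rewrite coefD; exact: carrierD. Qed.

Lemma poly_overB p q : poly_over R p -> poly_over R q -> poly_over R (p - q).
Proof. by move=> Rp Rq k; rewrite coefB; exact: carrierB. Qed.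

Lemma poly_overM p q : poly_over R p -> poly_over R q -> poly_over R (p * q).
Proof. by move=> Rp Rq k; rewrite coefM; apply: carrier_sum => j _; exact: carrierM. Qed.

Lemma poly_overZ c p : carrier R c -> poly_over R p -> poly_over R (c *: p).
Proof. by move=> Rc Rp k; rewrite coefZ; exact: carrierM. Qed.

End PolyOver.

Section PolySubring.
Variables (K : fieldType) (R : subring K).

Lemma poly_subring_closed :
  GRing.subring_closed (fun f : ratfun K => f \in [set tofrac p | p in poly_over R]).
Proof.
split=> [|f g|f g]; rewrite !unfold_in.
- by apply/mem_set; exists 1; [exact/poly_overC/carrier1 | rewrite tofrac1].
- move=> /set_mem [p Rp <-] /set_mem [q Rq <-]; apply/mem_set.
  by exists (p - q); [exact: poly_overB | rewrite tofracB].
- move=> /set_mem [p Rp <-] /set_mem [q Rq <-]; apply/mem_set.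
  by exists (p * q); [exact: poly_overM | rewrite tofracM].
Qed.

Definition poly_subring : subring (ratfun K) := Subring poly_subring_closed.

Lemma poly_subring_sub (S : subring (ratfun K)) :
  (forall c, carrier R c -> carrier S (to_ratfun c)) -> carrier S (tofrac 'X) ->
  forall p, poly_over R p -> carrier S (tofrac p).
Proof.
move=> RS SX p Rp; rewrite -[p]coefK poly_def rmorph_sum; apply: carrier_sum => k _.
rewrite /= -mul_polyC tofracM tofracXn; apply: carrierM; first exact: RS.
exact: carrierX.
Qed.

End PolySubring.

Section Nagata.
Variables (K : fieldType) (R : subring K).
Hypothesis locR : is_local R.
Implicit Types p q : {poly K}.

(** In a local ring a sum equal to 1 has a unit term, so a combination of the coefficients equal to
    1 exhibits a unit coefficient; conversely, the inverse of a single unit coefficient is such a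
    combination. *)
Lemma primitiveP p : primitive R p <-> poly_over R p /\ exists k, unit_in R p`_k.
Proof.
split=> [[Rp [c [Rc c1]]]|[Rp [k [pk0 _ Rpk]]]].
  split=> //; have [||k Rk] := @is_local_sum _ _ _ (index_enum 'I_(size p)) (fun i => c i * p`_i) locR.
  - by move=> i; exact: carrierM.
  - by rewrite c1; exact: unit_in1.
  - by exists k; apply: (unit_inMl (Rp k) (Rc k)); rewrite mulrC.
split=> //; exists (fun j => if j == k then (p`_k)^-1 else 0); split=> [j|].
  by case: eqP => // _; exact: carrier0.
have kp : (k < size p)%N by rewrite ltnNge; apply: contraNN pk0 => /leq_sizeP ->.
rewrite (bigD1 (Ordinal kp))//= eqxx mulVf// big1 ?addr0// => j.
by rewrite -val_eqE /= => /negbTE ->; rewrite mul0r.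
Qed.

Lemma primitive_over p : primitive R p -> poly_over R p.
Proof. by case. Qed.

Lemma primitive_factor p q : poly_over R p -> poly_over R q ->
  primitive R (p * q) -> primitive R p.
Proof.
move=> Rp Rq /primitiveP [_ [k]]; rewrite coefM => Rk.
have [j|j Rj] := is_local_sum locR _ Rk; first exact: carrierM.
by apply/primitiveP; split=> //; exists j; exact: unit_inMl (Rp _) (Rq _) Rj.
Qed.

Lemma primitive_add p q : poly_over R p -> poly_over R q ->
  primitive R (p + q) -> primitive R p \/ primitive R q.
Proof.
move=> Rp Rq /primitiveP [_ [k]]; rewrite coefD => /(locR (Rp k) (Rq k)) [Rk|Rk].
  by left; apply/primitiveP; split=> //; exists k.
by right; apply/primitiveP; split=> //; exists k.
Qed.

(* Gauss's lemma: the product of the first unit coefficients of p and q differs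
   from a coefficient of p q by a nonunit. *)
Lemma primitiveM p q : primitive R p -> primitive R q -> primitive R (p * q).
Proof.
have first_unit r : primitive R r -> exists m, unit_in R r`_m /\
    forall j, (j < m)%N -> ~ unit_in R r`_j.
  move=> /primitiveP [_ [k rk]].
  have ex : exists k, `[< unit_in R r`_k >] by exists k; exact/asboolP.
  exists (ex_minn ex); case: ex_minnP => m /asboolP rm min; split=> // j jm.
  by move=> /asboolP /min; rewrite leqNgt jm.
move=> pp pq; have [[Rp _] [Rq _]] := (pp, pq).
have [m [pm pmin]] := first_unit _ pp; have [n [qn qmin]] := first_unit _ pq.
apply/primitiveP; split; first exact: poly_overM.
exists (m + n)%N; apply: contrapT => npq.
have : unit_in R (p`_m * q`_n) by exact: unit_inM.
have -> : p`_m * q`_n = (p * q)`_(m + n) +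
    - \sum_(j < (m + n).+1 | j != inord m) p`_j * q`_(m + n - j).
  rewrite coefM (bigD1 (inord m))//= inordK ?ltnS ?leq_addr//.
  by rewrite addKn addrK.
move=> /locR [||//|].
- exact: poly_overM.
- by apply/carrierN/carrier_sum => j _; exact: carrierM.
rewrite -sumrN => /[dup] U.
have : exists j : 'I_(m + n).+1, j != inord m /\ unit_in R (- (p`_j * q`_(m + n - j))).
  have [||j] := @is_local_sum _ R _ (index_enum 'I_(m + n).+1)
    (fun j => if j != inord m then - (p`_j * q`_(m + n - j)) else 0) locR.
  - by move=> j; case: ifP => _; [exact/carrierN/carrierM | exact: carrier0].
  - by rewrite -big_mkcond.
  - by case: ifP => [jm Rj|_ [/eqP//]]; exists j.
move=> [j [jm Rj]] _.
have /unit_inMl Rpq : unit_in R (p`_j * q`_(m + n - j) * -1) by rewrite mulrN1.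
have {}Rpq : unit_in R (p`_j * q`_(m + n - j)).
  by apply: Rpq; [exact: carrierM | exact/carrierN/carrier1].
have [jltm|mltj|jE] := ltngtP j m.
- by apply: (pmin _ jltm); exact: unit_inMl (Rp _) (Rq _) Rpq.
- rewrite mulrC in Rpq; apply: (qmin (m + n - j)%N).
    by rewrite ltn_subLR ?ltn_add2r// -ltnS ltn_ord.
  exact: unit_inMl (Rq _) (Rp _) Rpq.
- by move: jm; rewrite -val_eqE /= inordK ?jE ?eqxx// ltnS leq_addr.
Qed.

Lemma primitive1 : primitive R 1.
Proof.
apply/primitiveP; split; first exact/poly_overC/carrier1.
by exists 0%N; rewrite coef1; exact: unit_in1.
Qed.

Lemma primitive_neq0 p : primitive R p -> p != 0.
Proof.
move=> /primitiveP [_ [k [pk0 _ _]]]; apply: contraNneq pk0 => ->.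
by rewrite coef0.
Qed.

Lemma NagataP f : carrier (Nagata R) f <->
  exists p q, [/\ poly_over R p, primitive R q & f = tofrac p / tofrac q].
Proof.
rewrite /Nagata -[[set tofrac p | p in poly_over R]]/(carrier (poly_subring R)).
rewrite localizationE.
- split=> [[_ [p Rp <-] [_ [q Rq <-] <-]]|[p [q [Rp Rq ->]]]]; first by exists p, q.
  by exists (tofrac p); [exists p|exists (tofrac q) => //; exists q].
- by exists 1; [exact: primitive1 | rewrite tofrac1].
- move=> _ _ [p Rp <-] [q Rq <-]; exists (p * q); last by rewrite tofracM.
  exact: primitiveM.
- by move=> [p /primitive_neq0 + /eqP]; rewrite tofrac_eq0 => /negP.
- by move=> _ [p [Rp _] <-]; exists p.
Qed.

Lemma Nagata_poly p : poly_over R p -> carrier (Nagata R) (tofrac p).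
Proof.
move=> Rp; apply/NagataP; exists p, 1; split=> //; first exact: primitive1.
by rewrite tofrac1 divr1.
Qed.

Lemma unit_in_Nagata p : poly_over R p ->
  unit_in (Nagata R) (tofrac p) <-> primitive R p.
Proof.
move=> Rp; split=> [[p0 _ /NagataP [r [s [Rr Rs pE]]]]|Pp].
  have s0 : tofrac s != 0 :> ratfun K by rewrite tofrac_eq0 primitive_neq0.
  suff E : p * r = s by apply: primitive_factor Rp Rr _; rewrite E.
  apply/eqP; rewrite -tofrac_eq tofracM; apply/eqP.
  exact: mulr_of_inv p0 s0 pE.
split; first by rewrite tofrac_eq0 primitive_neq0.
  exact: Nagata_poly.
apply/NagataP; exists 1, p; split=> //; first exact/poly_overC/carrier1.
by rewrite tofrac1 div1r.
Qed.

(** When p/q + r/s is a unit, its numerator p s + r q is primitive. A unit coefficient of this sum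
    comes from p s or from r q, and a factor of a primitive polynomial is primitive. *)
Lemma Nagata_local : is_local (Nagata R).
Proof.
move=> f g /NagataP [p [q [Rp Pq ->]]] /NagataP [r [s [Rr Ps ->]]].
have [Rq Rs] := (primitive_over Pq, primitive_over Ps).
have Uq : unit_in (Nagata R) (tofrac q) by exact/unit_in_Nagata.
have Us : unit_in (Nagata R) (tofrac s) by exact/unit_in_Nagata.
move=> /(unit_in_addf Uq Us) U.
have Pps : primitive R (p * s + r * q).
  apply/unit_in_Nagata; first by apply: poly_overD; exact: poly_overM.
  by rewrite tofracD !tofracM.
have [||P|P] := primitive_add _ _ Pps; try exact: poly_overM.
  left; apply: unit_inM (unit_inV Uq); apply/unit_in_Nagata => //.
  exact: primitive_factor P.
right; apply: unit_inM (unit_inV Us); apply/unit_in_Nagata => //.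
exact: primitive_factor P.
Qed.

Lemma Nagata_dominated : dominated (@to_ratfun K) R (Nagata R).
Proof.
split=> c Rc; first exact/Nagata_poly/poly_overC.
move=> /unit_in_Nagata; have Rc' := poly_overC Rc => /(_ Rc').
move=> /primitiveP [_ [k]]; rewrite coefC; case: ifP => // _ [/eqP//].
Qed.

End Nagata.

(** * The charts D[H/x] of a projective model *)

Section QuotientRing.
Variables (K : fieldType) (D : subring K) (H : set K).
Implicit Types (x y : K) (R : subring K).

Local Notation Dq := (quotient_ring D H).

Lemma quotient_ring_base x : carrier D `<=` carrier (Dq x).
Proof. by move=> c Dc A AS; apply: AS; left. Qed.

Lemma quotient_ring_gen x y : H y -> carrier (Dq x) (y / x).
Proof. by move=> Hy A AS; apply: AS; right; exists y. Qed.

Lemma quotient_ring_sub x R : carrier D `<=` carrier R ->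
  (forall y, H y -> carrier R (y / x)) -> carrier (Dq x) `<=` carrier R.
Proof. by move=> DR HR c; apply=> z [/DR|[y /HR ? <-]]. Qed.

(** This is homogenization: (z/x)(x/y) = z/y, so N only has to bound the degree of c in the
    generators. The property is asked of all n from N on, so that the bounds of several elements can
    be added; the c that have it form a subring containing the generators of D[H/x]. *)
Lemma quotient_ring_shift x y c : H x -> x != 0 -> y != 0 -> carrier (Dq x) c ->
  exists N, forall n, (N <= n)%N -> carrier (Dq y) (c * (x / y) ^+ n).
Proof.
move=> Hx x0 y0.
pose B : set K := [set c | exists N, forall n, (N <= n)%N -> carrier (Dq y) (c * (x / y) ^+ n)].
have Bs : GRing.subring_closed (fun c => c \in B).
  split=> [|a b|a b]; rewrite !unfold_in.
  - apply/mem_set; exists 0%N => n _; rewrite mul1r; apply: carrierX.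
    exact: quotient_ring_gen.
  - move=> /set_mem [N aN] /set_mem [M bM]; apply/mem_set; exists (N + M)%N => n Nn.
    rewrite mulrBl; apply: carrierB; [apply: aN | apply: bM]; apply: leq_trans Nn.
      exact: leq_addr.
    exact: leq_addl.
  - move=> /set_mem [N aN] /set_mem [M bM]; apply/mem_set; exists (N + M)%N => n Nn.
    have Nn' : (N <= n)%N by apply: leq_trans Nn; exact: leq_addr.
    rewrite -(subnKC Nn') exprD mulrACA; apply: carrierM; first exact: aN.
    by apply: bM; rewrite leq_subRL// .
suff DB : carrier (Dq x) `<=` carrier (Subring Bs) by move=> /DB.
apply: quotient_ring_sub => [d Dd|z Hz].
  exists 0%N => n _; apply: carrierM; first exact: quotient_ring_base.
  by apply: carrierX; exact: quotient_ring_gen.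
exists 1%N => -[//|n] _; rewrite exprS mulrA mulrA divfK//.
by apply: carrierM; [|apply: carrierX]; exact: quotient_ring_gen.
Qed.

End QuotientRing.

Lemma seq_eventually (T : eqType) (s : seq T) (P : T -> nat -> Prop) :
  (forall a, a \in s -> exists N, forall n, (N <= n)%N -> P a n) ->
  exists N, forall n, (N <= n)%N -> forall a, a \in s -> P a n.
Proof.
elim: s => [|a s IHs] Ps; first by exists 0%N.
have [|N sN] := IHs; first by move=> b bs; apply: Ps; rewrite inE bs orbT.
have [|M aM] := Ps a; first by rewrite inE eqxx.
exists (N + M)%N => n Nn b; rewrite inE => /orP [/eqP ->|bs].
  by apply: aM; apply: leq_trans Nn; exact: leq_addl.
by apply: sN => //; apply: leq_trans Nn; exact: leq_addr.
Qed.

Section Model.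
Variables (K : fieldType) (D : subring K) (r : seq K).
Let H : set K := [set` r].
Let X := W_model D H.
Hypothesis X_local : premodel D X.
Implicit Types (x y : K) (R : subring K).

Local Notation Dq := (quotient_ring D H).

Lemma model_base R : X R -> carrier D `<=` carrier R.
Proof. by move=> XR; have [_ /(_ _ XR) []] := X_local. Qed.

Lemma modelP R : X R <-> exists x, [/\ x \in r, x != 0 & localized (Dq x) R].
Proof.
split=> [[x [xr /eqP x0] /localizationsP xR]|[x [xr /eqP x0 /localizationsP xR]]].
  by exists x.
by exists x.
Qed.

Lemma model_is_local R : X R -> is_local R.
Proof. by move=> /modelP [x [_ _ []]]. Qed.

(** R is a localization of some D_y. As y/x lies in D_x and x/y in D_y, y/x is a unit of R, and
    multiplying numerator and denominator by a high power of it moves both from D_y into D_x. *)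
Lemma model_localized R x : X R -> x \in r -> x != 0 ->
  carrier (Dq x) `<=` carrier R -> localized (Dq x) R.
Proof.
move=> /modelP [y [yr y0 [yR locR fr]]] xr x0 xR; split=> // c /fr [a [s [ya ys Rs ->]]].
have [N aN] := @quotient_ring_shift _ D H _ _ _ yr y0 x0 ya.
have [M sM] := @quotient_ring_shift _ D H _ _ _ yr y0 x0 ys.
have Ryx : unit_in R (y / x).
  split; first by rewrite mulf_neq0 ?invr_eq0.
    exact/xR/quotient_ring_gen.
  by rewrite invf_div; exact/yR/quotient_ring_gen.
exists (a * (y / x) ^+ (N + M)), (s * (y / x) ^+ (N + M)); split.
- exact/aN/leq_addr.
- exact/sM/leq_addl.
- by apply: unit_inM => //; exact: unit_inX.
- by rewrite -mulf_div divff ?mulr1// expf_neq0// mulf_neq0 ?invr_eq0.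
Qed.

(** Separatedness of the model. With R over D_x and R' over D_y, the ring T contains the images of
    y/x, from R, and of x/y, from R'. So y/x is a unit of T, hence of R by domination; thus R
    contains D_y, and uniqueness on one chart applies. *)
Lemma model_dominated_uniq (L : fieldType) (i : {rmorphism K -> L}) (T : subring L) R R' :
  X R -> X R' -> dominated i R T -> dominated i R' T -> R = R'.
Proof.
move=> XR XR' RT RT'; have /modelP [x [xr x0 xR]] := XR.
have /modelP [y [yr y0 yR']] := XR'.
have Rgen z w S : z \in r -> localized (Dq w) S -> carrier S (z / w).
  by move=> zr [wS _ _]; apply: wS; exact: quotient_ring_gen.
have Ryx := Rgen _ _ _ yr xR; have Rxy' := Rgen _ _ _ xr yR'.
have yx0 : y / x != 0 by rewrite mulf_neq0 ?invr_eq0.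
have [RT1 RT2] := RT; have [RT'1 RT'2] := RT'.
have Ryx' : unit_in R (y / x).
  apply: RT2 => //; split; rewrite ?fmorph_eq0//; first exact: RT1.
  by rewrite -fmorphV invf_div; exact: RT'1.
suff yR : localized (Dq y) R by exact: dominated_uniq yR yR' RT RT'.
apply: model_localized => //; apply: quotient_ring_sub; first exact: model_base.
move=> z zr; have -> : z / y = z / x * (y / x)^-1 by rewrite invf_div mulrA divfK.
by apply: carrierM; [exact: Rgen | have [] := Ryx'].
Qed.

Lemma model_is_scheme : is_scheme (model_space X).
Proof.
have [[R0 XR0] Xfrac] := X_local.
have /modelP [x [xr x0 xR0]] := XR0.
have [R xR Runit] := exists_fraction_field (Dq x).
have XR : X R by apply/modelP; exists x.
have R0R := fraction_field_max xR Runit xR0.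
(* The generic point is K itself: c is a fraction a/b over R0, and b is in turn a fraction over D_x
   whose nonzero numerator is a unit of R. *)
have Rall c : carrier R c.
  have [_ _ /(_ c) [a [b [R0a R0b b0 ->]]]] := Xfrac _ XR0.
  apply: carrierM; first exact: R0R.
  have [_ _ /(_ _ R0b) [p [q [xp xq R0q bE]]]] := xR0.
  have [xsub _ _] := xR; rewrite bE invf_div; apply: carrierM; first exact: xsub.
  have p0 : p != 0 by apply: contraNneq b0 => p0; rewrite bE p0 mul0r.
  by have [] := Runit _ xp p0.
split; first by apply: (@model_space_sheaf _ _ (zpoint XR)) => y c _; exact: Rall.
  exact: model_space_locally_ringed model_is_local.
move=> y; have /modelP [z [zr z0 zy]] := ring_ofP y.
(* The chart of z is cut out by the finitely many conditions that h/z belongs to the ring; a member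
   of the model satisfying them contains D_z, hence is a localization of it. *)
pose U := Opens (@zariski_basic_open _ X _ (finite_image (fun h => h / z) (finite_seq r))).
have UP w : oset U w <-> localized (Dq z) (ring_of w).
  split=> [Uw|[zw _ _] _ [h hr <-]]; last exact/zw/quotient_ring_gen.
  apply: model_localized => //; first exact: ring_ofP.
  apply: quotient_ring_sub; first exact: model_base (ring_ofP w).
  by move=> h hr; apply: Uw; exists h.
exists U, _, (chart UP); split; first exact/UP.
by apply: chart_is_spec => S zS; apply/modelP; exists z.
Qed.

End Model.

Lemma div_scaled (F : fieldType) (a b f : F) : b != 0 -> a / b / (b^-1 * f) = a / f.
Proof. by move=> b0; rewrite -mulrA -invfM mulrA mulfV// mul1r. Qed.

Lemma div_divr (F : fieldType) (a b f : F) : f != 0 -> (a / f) / (b / f) = a / b.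
Proof. by move=> f0; rewrite invf_div mulrA divfK. Qed.

Lemma mulr_div_cancel (F : fieldType) (a s g : F) : s != 0 -> g = a / s -> g * s = a.
Proof. by move=> s0 ->; rewrite divfK. Qed.

Lemma sum_divl (F : fieldType) (n : nat) (a b : nat -> F) (f : F) : f != 0 ->
  f = \sum_(k < n) a k * b k -> \sum_(k < n) a k / f * b k = 1.
Proof.
move=> f0 fE; under eq_bigr do rewrite mulrAC.
by rewrite -mulr_suml -fE mulfV.
Qed.

Lemma tofracZ (K : fieldType) (c : K) (p : {poly K}) :
  tofrac (c *: p) = to_ratfun c * tofrac p.
Proof. by rewrite -mul_polyC tofracM. Qed.

(** * The ring [Dstar]: the elements x/h and denominators over one chart *)

Section Dstar.
Variables (K : fieldType) (D : subring K) (r : seq K).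
Let H : set K := [set` r].
Let X := W_model D H.
Hypothesis X_local : premodel D X.
Implicit Types (x y : K) (R : subring K) (S : subring (ratfun K)) (p q : {poly K}).

Local Notation Dq := (quotient_ring D H).
Let Dstar := Nagata_inter X.
Let XP := @modelP K D r.
Let locX := @model_is_local K D r.

Lemma Dstar_poly p : poly_over D p -> carrier Dstar (tofrac p).
Proof.
move=> Dp R XR; apply: Nagata_poly; first exact: locX.
by move=> k; exact: (model_base X_local XR).
Qed.

Lemma Dstar_base c : carrier D c -> carrier Dstar (to_ratfun c).
Proof. by move=> Dc; apply: Dstar_poly; exact: poly_overC. Qed.

Lemma Dstar_var : carrier Dstar (tofrac 'X).
Proof. by apply: Dstar_poly; rewrite -['X]expr1; exact: poly_overXn. Qed.

(** c/G = (c/y) / (G/y), and y may be adapted to R: this is how one fraction is seen to lie in all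
    the R(t) at once. *)
Lemma Dstar_ratio c (G : {poly K}) :
  (forall R, X R -> exists y, [/\ y != 0, carrier R (c / y) & primitive R (y^-1 *: G)]) ->
  carrier Dstar (to_ratfun c / tofrac G).
Proof.
move=> GX R XR; have [y [y0 Rc Py]] := GX R XR; apply/NagataP; first exact: locX.
exists (c / y)%:P, (y^-1 *: G); split=> //; first exact: poly_overC.
rewrite tofracZ -/(to_ratfun _) rmorphM !fmorphV; apply/esym/div_scaled.
by rewrite fmorph_eq0.
Qed.

Lemma generators_over R y : carrier (Dq y) `<=` carrier R ->
  poly_over R (y^-1 *: Poly r).
Proof.
move=> yR k; rewrite coefZ coef_Poly mulrC; case: (ltnP k (size r)) => kr.
  by apply/yR/quotient_ring_gen; exact: mem_nth.
by rewrite nth_default// mul0r; exact: carrier0.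
Qed.

Lemma generators_primitive R y : X R -> y \in r -> y != 0 ->
  carrier (Dq y) `<=` carrier R -> primitive R (y^-1 *: Poly r).
Proof.
move=> XR yr y0 yR; apply/primitiveP; first exact: locX.
split; first exact: generators_over.
exists (index y r); rewrite coefZ coef_Poly nth_index// mulVf//; exact: unit_in1.
Qed.

Lemma generators_neq0 : Poly r != 0.
Proof.
have [[R XR] _] := X_local; have /XP [y [yr y0 [yR _ _]]] := XR.
have := primitive_neq0 (locX XR) (generators_primitive XR yr y0 yR).
by apply: contraNneq => ->; rewrite scaler0.
Qed.

Lemma Dstar_generator x : x \in r -> carrier Dstar (to_ratfun x / tofrac (Poly r)).
Proof.
move=> xr; apply: Dstar_ratio => R XR; have /XP [y [yr y0 [yR _ _]]] := XR.
exists y; split=> //; first by apply/yR/quotient_ring_gen.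
exact: generators_primitive.
Qed.

(** Since h is the sum of the r_k t^k, the elements (r_k/h) t^k add up to 1, and one of them is a
    unit of the local ring S. *)
Lemma generators_chart S : is_local S -> carrier Dstar `<=` carrier S ->
  exists x, [/\ x \in r, x != 0 & unit_in S (to_ratfun x / tofrac (Poly r))].
Proof.
move=> locS DS; have h0 : tofrac (Poly r) != 0 :> ratfun K.
  by rewrite tofrac_eq0 generators_neq0.
have gS k : (k < size r)%N -> carrier S (to_ratfun r`_k / tofrac (Poly r)).
  by move=> kr; apply/DS/Dstar_generator; exact: mem_nth.
have tS k : carrier S (tofrac 'X^k).
  by apply/DS/Dstar_poly; exact: poly_overXn.
have [||k Sk] := @is_local_sum _ S _ (index_enum 'I_(size r))
    (fun k => to_ratfun r`_k / tofrac (Poly r) * tofrac 'X^k) locS.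
- by move=> k; apply: carrierM => //; exact: gS.
- rewrite (sum_divl (a := fun k => to_ratfun r`_k) (b := fun k => tofrac 'X^k) h0).
    exact: unit_in1.
  have {1}-> : Poly r = \sum_(k < size r) r`_k *: 'X^k.
    by rewrite -poly_def; apply/polyP => k; rewrite coef_Poly coef_poly; case: ltnP => // kr; rewrite nth_default.
  by rewrite rmorph_sum; apply: eq_bigr => k _; exact: tofracZ.
have {Sk} Sk := unit_inMl (gS k (ltn_ord k)) (tS k) Sk.
exists r`_k; split=> //; first exact: mem_nth.
have [+ _ _] := Sk; apply: contraNneq => ->.
by rewrite rmorph0 mul0r.
Qed.

(** y/x = (y/h) / (x/h), where y/h lies in [Dstar] and x/h is a unit of S. *)
Lemma chart_of_unit S x : carrier Dstar `<=` carrier S -> x \in r ->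
  unit_in S (to_ratfun x / tofrac (Poly r)) ->
  forall c, carrier (Dq x) c -> carrier S (to_ratfun c).
Proof.
move=> DS xr Ux c xc.
have Bs : GRing.subring_closed (fun c => c \in [set c | carrier S (to_ratfun c)]).
  split=> [|a b|a b]; rewrite !unfold_in.
  - by apply/mem_set; rewrite /= rmorph1; exact: carrier1.
  - by move=> /set_mem Sa /set_mem Sb; apply/mem_set; rewrite /= rmorphB; exact: carrierB.
  - by move=> /set_mem Sa /set_mem Sb; apply/mem_set; rewrite /= rmorphM; exact: carrierM.
suff : carrier (Dq x) `<=` carrier (Subring Bs) by move=> /(_ _ xc).
apply: quotient_ring_sub => [d Dd|y yr]; first exact/DS/Dstar_base.
suff : carrier S (to_ratfun y / to_ratfun x) by rewrite /= rmorphM fmorphV.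
have h0 : tofrac (Poly r) != 0 :> ratfun K by rewrite tofrac_eq0 generators_neq0.
rewrite -(div_divr _ _ h0); apply: carrierM; first exact/DS/Dstar_generator.
by have [] := Ux.
Qed.

(* The coefficients of the q in D_x[t] with q f in D_x[t] form an ideal (shift and
   add), which lies in no prime of D_x because f is in R(t) for every localization
   R of D_x. *)
Lemma Dstar_denominator (f : ratfun K) x : carrier Dstar f -> x \in r -> x != 0 ->
  exists q p, [/\ poly_over (Dq x) q, poly_over (Dq x) p, tofrac p = f * tofrac q
    & exists k, q`_k = 1].
Proof.
move=> Df xr x0.
pose J q := poly_over (Dq x) q /\ exists2 p, poly_over (Dq x) p & tofrac p = f * tofrac q.
have JD q q' : J q -> J q' -> J (q + q').
  move=> [xq [p xp pE]] [xq' [p' xp' pE']]; split; first exact: poly_overD.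
  by exists (p + p'); [exact: poly_overD | rewrite !tofracD mulrDr pE pE'].
have JM s q : poly_over (Dq x) s -> J q -> J (s * q).
  move=> xs [xq [p xp pE]]; split; first exact: poly_overM.
  by exists (s * p); [exact: poly_overM | rewrite !tofracM pE mulrCA].
pose I : set K := [set c | exists2 q, J q & exists k, q`_k = c].
have II : ideal_of (Dq x) I.
  split=> [_ [q [xq _] [k <-]]|||].
  - exact: xq.
  - exists 0; last by exists 0%N; rewrite coef0.
    by split; [exact: poly_over0 | exists 0; [exact: poly_over0 | rewrite tofrac0 mulr0]].
  - move=> _ _ [q Jq [k <-]] [q' Jq' [k' <-]].
    exists ('X^k' * q + 'X^k * q'); first by apply: JD; apply: JM => //; exact: poly_overXn.
    exists (k + k')%N; rewrite coefD !coefXnM ltnNge leq_addl addnK /=.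
    by rewrite ltnNge leq_addr addKn.
  - move=> a _ xa [q Jq [k <-]]; exists (a%:P * q); last by exists k; rewrite coefCM.
    by apply: JM => //; exact: poly_overC.
have [q [xq [p xp pE]] [k qk]] : I 1; last by exists q, p; split=> //; exists k.
apply: contrapT => I1.
have [n|R [xR _ RI]] := exists_localized_avoiding II (carrier1 _); first by rewrite expr1n.
have XR : X R by apply/XP; exists x.
have locR := locX XR.
have /(NagataP locR) [p [q [Rp Pq fE]]] := Df R XR.
have /(primitiveP locR) [Rq [k Rk]] := Pq.
(* A single s clears the coefficients of both p and q, so s q_k belongs to I although it is a unit
   of R. *)
have [|s [xs Rs sH]] := localized_denom xR (finite_seq (p ++ q)).
  move=> c /=; rewrite mem_cat => /orP [|] /(nthP 0) [j _ <-]; [exact: Rp | exact: Rq].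
have xsP (u : {poly K}) : (forall j, u`_j \in (u : seq K) -> carrier (Dq x) (s * u`_j)) -> poly_over (Dq x) (s *: u).
  move=> uH j; rewrite coefZ; have [ju|ju] := ltnP j (size u).
    by apply: uH; exact: mem_nth.
  by rewrite nth_default// mulr0; exact: carrier0.
apply: (RI (s * q`_k)); last exact: unit_inM.
exists (s *: q); last by exists k; rewrite coefZ.
split; first by apply: xsP => j ju; apply: sH; rewrite /= mem_cat ju orbT.
exists (s *: p); first by apply: xsP => j ju; apply: sH; rewrite /= mem_cat ju.
rewrite !tofracZ mulrCA; congr (_ * _).
apply/esym/mulr_div_cancel => //; rewrite tofrac_eq0; exact: primitive_neq0 Pq.
Qed.

End Dstar.

Lemma mulr_div_scaled (F : fieldType) (a b f : F) : a != 0 -> b != 0 ->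
  f = (a * (f * b)) / (a * b).
Proof. by move=> a0 b0; rewrite -mulf_div divff// mul1r mulfK. Qed.

Lemma unit_in_scaled (F L : fieldType) (i : {rmorphism F -> L}) (A : subring L) a g :
  i a^-1 != 0 -> g != 0 -> carrier A (i a^-1 * g) -> carrier A (i a / g) ->
  unit_in A (i a^-1 * g).
Proof.
move=> a0 g0 Aag Aag'; split=> //; first exact: mulf_neq0.
by rewrite invfM -fmorphV invrK.
Qed.

Lemma div_of_fractions (F : fieldType) (p q p' q' : F) : q != 0 -> q' != 0 ->
  p / q / (p' / q') = p * q' / (q * p').
Proof. by move=> q0 q'0; rewrite invf_div mulf_div. Qed.

Lemma poly_over_shift (K : fieldType) (D : subring K) (H : set K) x y (p : {poly K}) :
  H x -> x != 0 -> y != 0 -> poly_over (quotient_ring D H x) p ->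
  exists N, forall n, (N <= n)%N -> poly_over (quotient_ring D H y) ((x / y) ^+ n *: p).
Proof.
move=> Hx x0 y0 xp.
have [c /(nthP 0) [k _ <-]|N pN] := @seq_eventually _ (p : seq K)
    (fun c n => carrier (quotient_ring D H y) (c * (x / y) ^+ n)).
  exact: quotient_ring_shift.
exists N => n Nn k; rewrite coefZ mulrC; have [kp|kp] := ltnP k (size p).
  by apply: pN => //; exact: mem_nth.
by rewrite nth_default// mul0r; exact: carrier0.
Qed.

(* When S contains R[t], this says that S is a localization of R[t]. *)
Definition poly_fractions (K : fieldType) (R : subring K) (S : subring (ratfun K)) :=
  forall f, carrier S f -> exists p q,
    [/\ poly_over R p, poly_over R q, unit_in S (tofrac q) & f = tofrac p / tofrac q].

(** * Homogeneous denominators, and localizations of [Dstar] as rings of fractions *)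

Section Fractions.
Variables (K : fieldType) (D : subring K) (r : seq K).
Let H : set K := [set` r].
Let X := W_model D H.
Hypothesis X_local : premodel D X.
Implicit Types (x y : K) (R : subring K) (S : subring (ratfun K)) (p q : {poly K}).

Local Notation Dq := (quotient_ring D H).
Let Dstar := Nagata_inter X.
Let XP := @modelP K D r.
Let locX := @model_is_local K D r.

(** The bound N is uniform in y because r is finite, and every larger n is allowed so that the
    different x can later share one exponent. *)
Lemma Dstar_homogeneous_at (f : ratfun K) x : carrier Dstar f -> x \in r -> x != 0 ->
  exists N, forall n, (N <= n)%N -> exists q p, [/\ tofrac p = f * tofrac q,
    exists k, q`_k = 1 & forall y, y \in r -> y != 0 ->
      poly_over (Dq y) ((x / y) ^+ n *: q) /\ poly_over (Dq y) ((x / y) ^+ n *: p)].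
Proof.
move=> Df xr x0; have [q [p [xq xp pE qk]]] := Dstar_denominator Df xr x0.
have [y yr|N yN] := @seq_eventually _ r (fun y n => y != 0 ->
    poly_over (Dq y) ((x / y) ^+ n *: q) /\ poly_over (Dq y) ((x / y) ^+ n *: p)).
  have [->|y0] := eqVneq y 0; first by exists 0%N.
  have [N qN] := @poly_over_shift _ D H _ _ _ xr x0 y0 xq.
  have [M pM] := @poly_over_shift _ D H _ _ _ xr x0 y0 xp.
  exists (N + M)%N => n Nn _; split; [apply: qN|apply: pM]; apply: leq_trans Nn.
    exact: leq_addr.
  exact: leq_addl.
by exists N => n Nn; exists q, p; split=> // y yr; exact: yN.
Qed.

(* G is the sum over x of x^N q_x, shifted so that the terms do not overlap, where
   q_x is the denominator of f over D_x with a coefficient 1. *)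
Lemma Dstar_homogeneous (f : ratfun K) : carrier Dstar f -> exists N G F,
  [/\ tofrac F = f * tofrac G,
      forall y, y \in r -> y != 0 -> poly_over (Dq y) ((y ^+ N)^-1 *: G) /\
                                     poly_over (Dq y) ((y ^+ N)^-1 *: F)
    & forall x, x \in r -> x != 0 -> exists k, G`_k = x ^+ N].
Proof.
move=> Df.
have [x xr|N rN] := @seq_eventually _ r (fun x n => x != 0 ->
    exists q p, [/\ tofrac p = f * tofrac q, exists k, q`_k = 1 &
    forall y, y \in r -> y != 0 ->
      poly_over (Dq y) ((x / y) ^+ n *: q) /\ poly_over (Dq y) ((x / y) ^+ n *: p)]).
  have [->|x0] := eqVneq x 0; first by exists 0%N.
  by have [N xN] := Dstar_homogeneous_at Df xr x0; exists N => n Nn _; exact: xN.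
exists N.
suff : forall s : seq K, {subset s <= r} -> exists G F,
  [/\ tofrac F = f * tofrac G,
      forall y, y \in r -> y != 0 -> poly_over (Dq y) ((y ^+ N)^-1 *: G) /\
                                     poly_over (Dq y) ((y ^+ N)^-1 *: F)
    & forall x, x \in s -> x != 0 -> exists k, G`_k = x ^+ N] by exact.
elim=> [|x s IHs] sr.
  exists 0, 0; split=> [|y yr y0|//]; first by rewrite tofrac0 mulr0.
  by rewrite scaler0; split; exact: poly_over0.
have [|G [F [FE GFy Gs]]] := IHs; first by move=> z zs; apply: sr; rewrite inE zs orbT.
have [x0|x0] := eqVneq x 0.
  exists G, F; split=> // z; rewrite inE => /orP [/eqP ->|zs z0]; first by rewrite x0 eqxx.
  exact: Gs.
have xr : x \in r by apply: sr; rewrite inE eqxx.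
have [q [p [pE [k qk] qpy]]] := rN N (leqnn N) x xr x0.
pose m := size G; exists (G + 'X^m * (x ^+ N *: q)), (F + 'X^m * (x ^+ N *: p)).
split=> [|y yr y0|z].
- rewrite !tofracD !tofracM !tofracZ FE pE mulrDr; congr (_ + _).
  by rewrite [in RHS]mulrCA; congr (_ * _); rewrite mulrCA.
- have [[yG yF] [yq yp]] := (GFy y yr y0, qpy y yr y0).
  have E (u v : {poly K}) : (y ^+ N)^-1 *: (u + 'X^m * (x ^+ N *: v)) =
      (y ^+ N)^-1 *: u + 'X^m * ((x / y) ^+ N *: v).
    rewrite scalerDr -!scalerAr scalerA; congr (_ + _ *: _).
    by rewrite exprMn exprVn mulrC.
  rewrite !E; split; apply: poly_overD => //; apply: poly_overM => //; exact: poly_overXn.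
- rewrite inE => /orP [/eqP -> _|zs z0].
    exists (m + k)%N; rewrite coefD coefXnM ltnNge leq_addr addKn coefZ qk mulr1.
    by rewrite nth_default ?leq_addr// add0r.
  have [j Gj] := Gs z zs z0; exists j; rewrite coefD coefXnM.
  (* The coefficient z^N is nonzero, so its index lies below the size of G and the shifted summand
     does not touch it. *)
  have -> : (j < m)%N; last by rewrite addr0.
  rewrite ltnNge; apply: contraTN z0 => jm; rewrite negbK.
  by move: Gj; rewrite nth_default// => /esym/eqP; rewrite expf_eq0 => /andP [].
Qed.

Lemma chart_poly_fractions S x : localized Dstar S -> x \in r -> x != 0 ->
  unit_in S (to_ratfun x / tofrac (Poly r)) -> poly_fractions (Dq x) S.
Proof.
move=> [DS locS fr] xr x0 Ux.
have xS : forall p, poly_over (Dq x) p -> carrier S (tofrac p).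
  apply: poly_subring_sub; last exact/DS/Dstar_var.
  exact: (chart_of_unit X_local DS xr Ux).
have frD f : carrier Dstar f -> exists p q,
    [/\ poly_over (Dq x) p, poly_over (Dq x) q, unit_in S (tofrac q) & f = tofrac p / tofrac q].
  move=> Df; have [N [G [F [FE GFy Gx]]]] := Dstar_homogeneous Df.
  have [xG xF] := GFy x xr x0; have xN0 : (x ^+ N)^-1 != 0 by rewrite invr_eq0 expf_neq0.
  have G0 : tofrac G != 0 :> ratfun K.
    rewrite tofrac_eq0; have [k Gk] := Gx x xr x0.
    by apply: contraTneq (expf_neq0 N x0) => G0; rewrite -Gk G0 coef0 eqxx.
  have ixN0 : to_ratfun (x ^+ N)^-1 != 0 by rewrite fmorph_eq0.
  exists ((x ^+ N)^-1 *: F), ((x ^+ N)^-1 *: G); split; [exact: xF | exact: xG | |].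
    have := xS _ xG; rewrite tofracZ => SG; apply: unit_in_scaled ixN0 G0 SG _.
    apply: DS.
    (* Here x^N/G is tested in R(t) on a chart y of R, not on x: G/y^N has the coefficient y^N/y^N =
       1, hence is primitive, and (x/y)^N lies in R. *)
    apply: Dstar_ratio => R XR; have /XP [y [yr y0 [yR _ _]]] := XR.
    have [yG _] := GFy y yr y0; exists (y ^+ N); split; first exact: expf_neq0.
      by rewrite -expr_div_n; apply/carrierX/yR/quotient_ring_gen.
    apply/primitiveP; first exact: locX.
    split; first by move=> k; apply: yR; exact: yG.
    have [k Gk] := Gx y yr y0; exists k; rewrite coefZ Gk mulVf ?expf_neq0//.
    exact: unit_in1.
  by rewrite !tofracZ FE; exact: mulr_div_scaled.
move=> f /fr [a [s [/frD [p [q [xp xq Uq aE]]] /frD [p' [q' [xp' xq' Uq' sE]]] Us fE]]].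
have [[q0 _ _] [q'0 _ _]] := (Uq, Uq').
(* The denominator s of f is p'/q', so p' = s q' is a unit of S and may enter a denominator. *)
have Up' : unit_in S (tofrac p').
  by move: (unit_inM Us Uq'); rewrite (mulr_div_cancel q'0 sE).
exists (p * q'), (q * p'); split; [exact: poly_overM | exact: poly_overM | |].
  by rewrite tofracM; exact: unit_inM Uq Up'.
have := div_of_fractions (tofrac p) (tofrac p') q0 q'0.
by rewrite -aE -sE -fE -(tofracM p q') -(tofracM q p').
Qed.

End Fractions.

Section PolyFractions.
Variables (K : fieldType) (R : subring K) (S : subring (ratfun K)).
Hypotheses (locS : is_local S) (RS : dominated (@to_ratfun K) R S).
Hypotheses (SX : carrier S (tofrac 'X)) (SR : poly_fractions R S).

(* If p = c q with q a unit of S, then some coefficient q_k is a unit of S, hence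
   of R, and c = p_k / q_k. *)
Lemma poly_fractions_contract c : carrier S (to_ratfun c) <-> carrier R c.
Proof.
have [RS1 RS2] := RS; split=> [/SR [p [q [Rp Rq Uq cE]]]|/RS1//].
have [q0 _ _] := Uq.
have pE : p = c *: q.
  apply/eqP; rewrite -tofrac_eq tofracZ; apply/eqP.
  exact: esym (mulr_div_cancel q0 cE).
have [||k Sk] := @is_local_sum _ S _ (index_enum 'I_(size q))
    (fun k => to_ratfun q`_k * tofrac 'X^k) locS.
- by move=> k; apply: carrierM; [exact: RS1 | rewrite tofracXn; exact: carrierX].
- move: Uq; rewrite -{1}[q]coefK poly_def rmorph_sum /=.
  by under eq_bigr do rewrite tofracZ.
have {Sk} Sk : unit_in S (to_ratfun q`_k).
  apply: unit_inMl Sk; first exact: RS1.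
  by rewrite tofracXn; exact: carrierX.
have [qk0 _ Rqk] := RS2 _ (Rq k) Sk.
have -> : c = p`_k / q`_k by rewrite pE coefZ mulfK.
exact: carrierM.
Qed.

End PolyFractions.

Lemma val_sum (F : fieldType) (A : subring F) (I : Type) (s : seq I) (P : pred I)
  (f : I -> subring_type A) : val (\sum_(i <- s | P i) f i) = \sum_(i <- s | P i) val (f i).
Proof. exact: (big_morph val). Qed.

Lemma val_mul (F : fieldType) (A : subring F) (a b : subring_type A) :
  val (a * b) = val a * val b.
Proof. by []. Qed.

(** * Flatness of localizations of R[t] *)

Section TensorFacts.
Variables (A B : comPzRingType) (phi : {rmorphism A -> B}) (M : lmodType A).
Implicit Types (m : M) (b : B).

Lemma tensor_zeror m : tensor_eq phi [:: (m, 0)] [::].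
Proof.
have := tensor_sym (tensor_scale phi 0 m 0).
by rewrite scale0r mulr0 => h; apply: tensor_trans h _; exact: tensor_zero.
Qed.

Lemma tensor_sumr (I : Type) (s : seq I) m (b : I -> B) :
  tensor_eq phi [:: (m, \sum_(k <- s) b k)] [seq (m, b k) | k <- s].
Proof.
elim: s => [|k s IHs]; first by rewrite big_nil; exact: tensor_zeror.
rewrite big_cons; apply: tensor_trans (tensor_addr _ _ _ _) _.
exact: (tensor_cat (u := [:: _]) (u' := [:: _])) (tensor_refl _ _) IHs.
Qed.

Lemma tensor_map (I : Type) (s : seq I) (w w' : I -> M * B) :
  (forall k, tensor_eq phi [:: w k] [:: w' k]) ->
  tensor_eq phi [seq w k | k <- s] [seq w' k | k <- s].
Proof.
move=> ww'; elim: s => [|k s IHs]; first exact: tensor_refl.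
exact: (tensor_cat (u := [:: _]) (u' := [:: _])) (ww' k) IHs.
Qed.

Lemma tensor_map_add (I : Type) (s : seq I) (f g : I -> M) (b : I -> B) :
  tensor_eq phi ([seq (f k, b k) | k <- s] ++ [seq (g k, b k) | k <- s])
    [seq (f k + g k, b k) | k <- s].
Proof.
elim: s => [|k s IHs]; first exact: tensor_refl.
set u := [seq (f k, b k) | k <- s] in IHs *; set v := [seq (g k, b k) | k <- s] in IHs *.
(* Tensors are lists whose only rearrangement exchanges two blocks; this brings the pair of g k next
   to that of f k. *)
have swap : tensor_eq phi (u ++ ((g k, b k) :: v)) ((g k, b k) :: u ++ v).
  have := tensor_cat (tensor_catC phi u [:: (g k, b k)]) (tensor_refl phi v).
  by rewrite -catA.
apply: (tensor_trans (v := [:: (f k, b k); (g k, b k)] ++ (u ++ v))).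
  exact: (tensor_cat (u := [:: _]) (u' := [:: _])) (tensor_refl _ _) swap.
apply: (tensor_cat (v' := [seq _ | k <- s]) (u' := [:: _])) _ IHs.
exact: tensor_sym (tensor_addl _ _ _ _).
Qed.

End TensorFacts.

Section FlatFractions.
Variables (K : fieldType) (R : subring K) (S : subring (ratfun K)).
Variable phi : {rmorphism subring_type R -> subring_type S}.
Hypothesis phiE : forall a, val (phi a) = to_ratfun (val a).
Hypotheses (SX : carrier S (tofrac 'X)) (SR : poly_fractions R S).

Local Notation A := (subring_type R).
Local Notation B := (subring_type S).
Implicit Types (p q s : {poly K}) (b : B).

(** The default 0 outside R makes this total, so that coefficients in K can act on M without
    carrying a membership proof. *)
Definition to_subring (c : K) : A :=
  if pselect (carrier R c) is left Rc then subr_of Rc else 0.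

Lemma to_subringK c : carrier R c -> val (to_subring c) = c.
Proof. by rewrite /to_subring; case: pselect. Qed.

Definition denominator q b := exists2 p, poly_over R p & tofrac p = val b * tofrac q.

(** The polynomial b q, which is unique since K[t] embeds in K(t); the default 0 is returned when b
    q is not a polynomial over R. *)
Definition numerator q b : {poly K} :=
  xget 0 [set p | poly_over R p /\ tofrac p = val b * tofrac q].

Lemma numeratorP q b : denominator q b ->
  poly_over R (numerator q b) /\ tofrac (numerator q b) = val b * tofrac q.
Proof.
move=> [p Rp pE]; rewrite /numerator; case: xgetP => [p' -> //|/(_ p)].
by case.
Qed.

Lemma numerator_uniq q b p : poly_over R p -> tofrac p = val b * tofrac q ->
  numerator q b = p.
Proof.
move=> Rp pE; have [|_ nE] := @numeratorP q b; first by exists p.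
by apply/eqP; rewrite -tofrac_eq nE pE.
Qed.

Definition denominators q (M : lmodType A) (u : seq (M * B)) :=
  forall w, w \in u -> denominator q w.2.

Definition admissible q := poly_over R q /\ unit_in S (tofrac q).

Lemma admissibleM q s : admissible q -> admissible s -> admissible (q * s).
Proof.
move=> [Rq Uq] [Rs Us]; split; first exact: poly_overM.
by rewrite tofracM; exact: unit_inM.
Qed.

Lemma denominatorM q s b : poly_over R s -> denominator q b -> denominator (s * q) b.
Proof.
move=> Rs [p Rp pE]; exists (s * p); first exact: poly_overM.
by rewrite (tofracM s p) (tofracM s q) pE mulrCA.
Qed.

Definition num_coef q k b : A := to_subring (numerator q b)`_k.

Lemma val_num_coef q k b : denominator q b -> val (num_coef q k b) = (numerator q b)`_k.
Proof. by move=> /numeratorP [Rn _]; rewrite to_subringK. Qed.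

(** Enlarging q to s q multiplies the numerator by s. Through this convolution, equality of all
    coefficients survives a change of denominator. *)
Lemma num_coefM q s k b : poly_over R s -> denominator q b ->
  num_coef (s * q) k b =
    \sum_(j < k.+1) to_subring s`_j * num_coef q (k - j) b.
Proof.
move=> Rs qb; have [Rn nE] := numeratorP qb; apply: val_inj.
rewrite val_num_coef; last exact: denominatorM.
rewrite (@numerator_uniq _ _ (s * numerator q b)); last 2 first.
- exact: poly_overM.
- by rewrite (tofracM s q) (tofracM s (numerator q b)) nE mulrCA.
rewrite coefM val_sum; apply: eq_bigr => j _.
by rewrite -(val_num_coef (k - j) qb) -[in LHS](to_subringK (Rs j)).
Qed.

Section Module.
Variable M : lmodType A.
Implicit Types (u v w : seq (M * B)).

Lemma exists_denominators u : exists2 q, admissible q & denominators q u.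
Proof.
elim: u => [|[m b] u [q aq qu]].
  exists 1; last by [].
  by split; [exact/poly_overC/carrier1 | rewrite tofrac1; exact: unit_in1].
have [p [s [Rp Rs Us bE]]] := SR (carrier_val b).
have [s0 _ _] := Us; have as_ : admissible s by [].
exists (s * q); first exact: admissibleM.
move=> w; rewrite inE => /orP [/eqP -> /=|wu]; last first.
  by apply: denominatorM => //; exact: qu.
rewrite mulrC; apply: denominatorM; first by have [] := aq.
by exists p => //; exact: esym (mulr_div_cancel s0 bE).
Qed.

(** When q is a denominator for u, this is the coefficient of t^k in the element q u of M[t]. *)
Definition coef_sum q k u : M := \sum_(w <- u) num_coef q k w.2 *: w.1.

Lemma coef_sum_cat q k u v : coef_sum q k (u ++ v) = coef_sum q k u + coef_sum q k v.
Proof. exact: big_cat. Qed.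

Lemma coef_sumM q s k u : poly_over R s -> denominators q u ->
  coef_sum (s * q) k u =
    \sum_(j < k.+1) to_subring s`_j *: coef_sum q (k - j) u.
Proof.
move=> Rs qu; rewrite /coef_sum.
under [RHS]eq_bigr do rewrite scaler_sumr.
rewrite exchange_big /=; rewrite !big_seq; apply: eq_bigr => w wu.
rewrite num_coefM //; last exact: qu.
by rewrite scaler_suml; apply: eq_bigr => j _; rewrite scalerA.
Qed.

Definition same_fraction_at q u v :=
  [/\ denominators q u, denominators q v & forall k, coef_sum q k u = coef_sum q k v].

(* Equality of u and v in M[t] localized at the polynomials that are units of S. *)
Definition same_fraction u v := exists2 q, admissible q & same_fraction_at q u v.

Lemma same_fraction_atM q s u v : poly_over R s ->
  same_fraction_at q u v -> same_fraction_at (s * q) u v.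
Proof.
move=> Rs [qu qv uv]; split=> [w wu|w wv|k].
- by apply: denominatorM => //; exact: qu.
- by apply: denominatorM => //; exact: qv.
- by rewrite !coef_sumM//; apply: eq_bigr => j _; rewrite uv.
Qed.

Lemma same_fraction_at_trans q u v w :
  same_fraction_at q u v -> same_fraction_at q v w -> same_fraction_at q u w.
Proof. by move=> [qu _ uv] [_ qw vw]; split=> // k; rewrite uv. Qed.

Lemma same_fraction_refl u : same_fraction u u.
Proof. by have [q aq qu] := exists_denominators u; exists q. Qed.

Lemma same_fraction_trans u v w :
  same_fraction u v -> same_fraction v w -> same_fraction u w.
Proof.
move=> [q aq uv] [s as_ vw]; exists (s * q); first exact: admissibleM.
apply: (@same_fraction_at_trans _ _ v); first by apply: same_fraction_atM; case: as_.
by rewrite mulrC; apply: same_fraction_atM; case: aq.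
Qed.

Lemma denominators_cat q u v :
  denominators q u -> denominators q v -> denominators q (u ++ v).
Proof. by move=> qu qv w; rewrite mem_cat => /orP [/qu|/qv]. Qed.

Lemma same_fraction_at_cat q u u' v v' : same_fraction_at q u u' ->
  same_fraction_at q v v' -> same_fraction_at q (u ++ v) (u' ++ v').
Proof.
move=> [qu qu' uu'] [qv qv' vv']; split=> [||k]; try exact: denominators_cat.
by rewrite !coef_sum_cat uu' vv'.
Qed.

Lemma same_fraction_cat u u' v v' : same_fraction u u' -> same_fraction v v' ->
  same_fraction (u ++ v) (u' ++ v').
Proof.
move=> [q aq uu'] [s as_ vv']; exists (s * q); first exact: admissibleM.
apply: same_fraction_at_cat; first by apply: same_fraction_atM => //; case: as_.
by rewrite mulrC; apply: same_fraction_atM => //; case: aq.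
Qed.

Lemma coef_sum1 q k (m : M) b : coef_sum q k [:: (m, b)] = num_coef q k b *: m.
Proof. exact: big_seq1. Qed.

Lemma denominators1 q (m : M) b : denominators q [:: (m, b)] <-> denominator q b.
Proof.
split=> [qb|qb w]; first by apply: (qb (m, b)); rewrite inE eqxx.
by rewrite inE => /eqP ->.
Qed.

Lemma num_coefD q k b b' : denominator q b -> denominator q b' ->
  denominator q (b + b') /\ num_coef q k (b + b') = num_coef q k b + num_coef q k b'.
Proof.
move=> qb qb'; have [[Rn nE] [Rn' nE']] := (numeratorP qb, numeratorP qb').
have E : tofrac (numerator q b + numerator q b') = val (b + b') * tofrac q.
  by rewrite tofracD nE nE' -mulrDl.
have Rnn' := poly_overD Rn Rn'.
have qbb' : denominator q (b + b') by exists (numerator q b + numerator q b').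
split=> //; apply: val_inj; rewrite val_num_coef// (numerator_uniq Rnn' E) coefD.
by rewrite -!val_num_coef.
Qed.

Lemma num_coefZ q k (a : A) b : denominator q b ->
  denominator q (phi a * b) /\ num_coef q k (phi a * b) = a * num_coef q k b.
Proof.
move=> qb; have [Rn nE] := numeratorP qb.
have E : tofrac (val a *: numerator q b) = val (phi a * b) * tofrac q.
  by rewrite tofracZ nE -phiE mulrA.
have Ran := poly_overZ (carrier_val a) Rn.
have qab : denominator q (phi a * b) by exists (val a *: numerator q b).
split=> //; apply: val_inj; rewrite val_num_coef// (numerator_uniq Ran E) coefZ.
by rewrite -val_num_coef.
Qed.

(** Each defining relation of the tensor product holds in the localized M[t]; finite lists have
    common denominators, and products of denominators handle transitivity and concatenation. *)
Lemma tensor_eq_same_fraction u v : tensor_eq phi u v -> same_fraction u v.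
Proof.
elim=> {u v} [u|u v _ [q aq [qu qv uv]]|u v w _ uv _ vw|u u' v v' _ uu' _ vv'|u v
  |m m' b|m b b'|a m b|b].
- exact: same_fraction_refl.
- by exists q => //; split.
- exact: same_fraction_trans uv vw.
- exact: same_fraction_cat.
- have [q aq quv] := exists_denominators (u ++ v); exists q => //; split=> // [w|k].
    by rewrite mem_cat orbC -mem_cat; exact: quv.
  by rewrite !coef_sum_cat addrC.
- have [q aq /denominators1 qb] := exists_denominators [:: (m, b)].
  exists q => //; split=> [||k]; first exact/denominators1.
    by apply: (@denominators_cat _ [:: _] [:: _]); exact/denominators1.
  by rewrite (@coef_sum_cat _ _ [:: _] [:: _]) !coef_sum1 scalerDr.
- have [q aq qbb'] := exists_denominators [:: (m, b); (m, b')].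
  have qb : denominator q b by apply: (qbb' (m, b)); rewrite inE eqxx.
  have qb' : denominator q b' by apply: (qbb' (m, b')); rewrite !inE eqxx orbT.
  exists q => //; split=> [|//|k]; first by apply/denominators1; case: (num_coefD 0 qb qb').
  rewrite (@coef_sum_cat _ _ [:: _] [:: _]) !coef_sum1.
  by have [_ ->] := num_coefD k qb qb'; rewrite scalerDl.
- have [q aq /denominators1 qb] := exists_denominators [:: (m, b)].
  exists q => //; split=> [||k]; first exact/denominators1.
    by apply/denominators1; case: (num_coefZ 0 a qb).
  rewrite !coef_sum1; have [_ ->] := num_coefZ k a qb.
  by rewrite scalerA mulrC.
- have [q aq q0] := exists_denominators [:: (0 : M, b)].
  by exists q => //; split=> // k; rewrite coef_sum1 scaler0 /coef_sum big_nil.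
Qed.

Section Monomials.
Variable q : {poly K}.
Hypothesis aq : admissible q.

Lemma monomialP k : carrier S (tofrac 'X^k / tofrac q).
Proof.
have [_ [_ _ Sq']] := aq; apply: carrierM Sq'.
by rewrite tofracXn; exact: carrierX.
Qed.

Definition monomial k : B := subr_of (monomialP k).

Lemma val_monomial k : val (monomial k) = tofrac 'X^k / tofrac q.
Proof. by []. Qed.

Lemma sum_monomials b N : denominator q b -> (size (numerator q b) <= N)%N ->
  b = \sum_(k <- iota 0 N) phi (num_coef q k b) * monomial k.
Proof.
move=> qb bN; have [Rn nE] := numeratorP qb; apply: val_inj; rewrite val_sum.
have [_ [q0 _ _]] := aq.
transitivity (tofrac (numerator q b) / tofrac q); first by rewrite nE mulfK.
have -> : numerator q b = \sum_(k <- iota 0 N) (numerator q b)`_k *: 'X^k.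
  rewrite -[LHS]coefK poly_def (_ : iota 0 N = index_iota 0 N); last by rewrite /index_iota subn0.
  rewrite big_mkord (big_ord_widen N (fun k => (numerator q b)`_k *: 'X^k)) //.
  rewrite big_mkcond; apply: eq_bigr => k _; case: ltnP => // kn.
  by rewrite nth_default// scale0r.
rewrite rmorph_sum mulr_suml; apply: eq_bigr => k _.
rewrite val_mul phiE val_monomial val_num_coef// mulrA; congr (_ / _).
exact: tofracZ.
Qed.

(** A normal form: each ring entry b is the sum of its numerator coefficients times t^k/q, and the
    coefficients move across the tensor sign. Terms beyond N are zero; allowing every larger n lets
    two tensors be written with the same length. *)
Lemma tensor_eq_monomials u : denominators q u ->
  exists N, forall n, (N <= n)%N ->
    tensor_eq phi u [seq (coef_sum q k u, monomial k) | k <- iota 0 n].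
Proof.
elim: u => [|[m b] u IHu] qu.
  exists 0%N => n _; elim: (iota 0 n) => [|k s IHs]; first exact: tensor_refl.
  apply: (tensor_cat (u := [::]) (u' := [:: _])) IHs.
  by rewrite /coef_sum big_nil; exact: tensor_sym (tensor_zero _ _ _).
have qb : denominator q b by apply: (qu (m, b)); rewrite inE eqxx.
have [|N uN] := IHu; first by move=> w wu; apply: qu; rewrite inE wu orbT.
exists (N + size (numerator q b))%N => n Nn.
have /uN un : (N <= n)%N by apply: leq_trans Nn; exact: leq_addr.
have bn : (size (numerator q b) <= n)%N by apply: leq_trans Nn; exact: leq_addl.
have mb : tensor_eq phi [:: (m, b)]
    [seq (num_coef q k b *: m, monomial k) | k <- iota 0 n].
  rewrite {1}(sum_monomials qb bn); apply: tensor_trans (tensor_sumr _ _ _ _) _.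
  by apply: tensor_map => k; exact: tensor_sym (tensor_scale _ _ _ _).
apply: tensor_trans (tensor_cat mb un) _.
have -> : [seq (coef_sum q k ((m, b) :: u), monomial k) | k <- iota 0 n] =
    [seq (num_coef q k b *: m + coef_sum q k u, monomial k) | k <- iota 0 n].
  by apply: eq_map => k; rewrite /coef_sum big_cons.
exact: tensor_map_add.
Qed.

End Monomials.

Lemma same_fraction_tensor_eq u v : same_fraction u v -> tensor_eq phi u v.
Proof.
move=> [q aq [qu qv uv]].
have [N uN] := tensor_eq_monomials aq qu; have [N' vN'] := tensor_eq_monomials aq qv.
have un := uN (N + N')%N (leq_addr _ _); have vn := vN' (N + N')%N (leq_addl _ _).
apply: tensor_trans un _; apply: tensor_sym; apply: tensor_trans vn _.
rewrite (eq_map (g := fun k => (coef_sum q k u, monomial aq k))); first exact: tensor_refl.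
by move=> k; rewrite uv.
Qed.

End Module.

(** A linear map acts on M[t] coefficientwise and leaves the ring entries alone, so the same q
    serves for u and v, and injectivity is applied to each coefficient. *)
Lemma flat_of_poly_fractions : flat_hom phi.
Proof.
move=> M N f inj_f u v /tensor_eq_same_fraction [q aq [qfu qfv fuv]].
apply: same_fraction_tensor_eq; exists q => //.
have qf w : denominators q [seq (f x.1, x.2) | x <- w] -> denominators q w.
  by move=> qw x xw; apply: (qw (f x.1, x.2)); exact: map_f xw.
have sumf k w : coef_sum q k [seq (f x.1, x.2) | x <- w] = f (coef_sum q k w).
  rewrite /coef_sum big_map linear_sum; apply: eq_bigr => x _ /=.
  by rewrite linearZ.
by split=> [||k]; [exact: qf | exact: qf | apply: inj_f; rewrite -!sumf].
Qed.

End FlatFractions.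

Lemma dominatesP (K : fieldType) (S : subring (ratfun K)) (R : subring K) :
  is_local S -> is_local R -> dominates S R <-> dominated (@to_ratfun K) R S.
Proof.
move=> locS locR; rewrite /dominates !is_local_maxid//.
split=> [[RS dom]|[RS dom]].
  have RS' c : carrier R c -> carrier S (to_ratfun c) by move=> Rc; apply: RS; exists c.
  split=> // c Rc Sc; apply: contrapT => nRc.
  have [_ /(_ nRc)] := dom (subr_of Rc) (subr_of (RS' _ Rc)) erefl.
  exact.
split=> [_ [c Rc <-]|a b ab]; first exact: RS.
rewrite /nonunits /= ab; split=> nu U; apply: nu; first exact: unit_in_morph U.
by apply: dom U; exact: carrier_val.
Qed.

Lemma unit_in_morphV (F L : fieldType) (i : {rmorphism F -> L}) (A : subring L) a g :
  unit_in A (i a^-1 * g) -> unit_in A (i a / g).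
Proof. by move=> /unit_inV; rewrite invfM -fmorphV invrK. Qed.

(** * Centers of localizations of [Dstar], and the domination morphism *)

Section Centers.
Variables (K : fieldType) (D : subring K) (r : seq K).
Let H : set K := [set` r].
Let X := W_model D H.
Hypothesis X_local : premodel D X.
Let Dstar := Nagata_inter X.

Lemma Dstar_center S : localized Dstar S ->
  exists R, [/\ X R, dominated (@to_ratfun K) R S & poly_fractions R S].
Proof.
move=> DS; have [Dsub locS _] := DS.
have [x [xr x0 Ux]] := generators_chart X_local locS Dsub.
have [R xR RS] := exists_center locS (chart_of_unit X_local Dsub xr Ux).
have [xsub _ _] := xR; exists R; split=> //; first by apply/modelP; exists x.
move=> f Sf; have [p [q [xp xq Uq fE]]] := chart_poly_fractions X_local DS xr x0 Ux Sf.
by exists p, q; split=> // k; exact: xsub.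
Qed.

(* The nonunits of R(t) contract to a prime of Dstar whose localization
   dominates R. *)
Lemma Dstar_center_surjective R : X R ->
  exists2 S, localized Dstar S & dominated (@to_ratfun K) R S.
Proof.
move=> XR; have locR := model_is_local XR; have locT := Nagata_local locR.
have DT : carrier Dstar `<=` carrier (Nagata R) by move=> f; apply.
have [S DS [ST STunit]] := @exists_center _ _ idfun _ _ locT DT.
have [Dsub locS _] := DS; exists S => //.
have [RT RTunit] := Nagata_dominated locR.
have /modelP [x [xr x0 [xR _ fr]]] := XR.
have Px := generators_primitive XR xr x0 xR.
(* As h/x is primitive over R, x/h is a unit of R(t). It lies in [Dstar], so it is already a unit of
   S, which puts D_x inside S; denominators of R over D_x then become units of S. *)
have UTx : unit_in (Nagata R) (to_ratfun x / tofrac (Poly r)).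
  apply: unit_in_morphV; rewrite -tofracZ; apply/unit_in_Nagata => //.
  exact: primitive_over Px.
have USx : unit_in S (to_ratfun x / tofrac (Poly r)).
  by apply: STunit UTx; apply: Dsub; exact: Dstar_generator.
have xS := chart_of_unit X_local Dsub xr USx.
have RS c : carrier R c -> carrier S (to_ratfun c).
  move=> /fr [a [s [xa xs Rs ->]]].
  have : unit_in S (to_ratfun s).
    by apply: STunit; [exact: xS | exact: unit_in_morph Rs].
  move=> [_ _ Ss']; rewrite rmorphM fmorphV; apply: carrierM Ss'.
  exact: xS.
split=> // c Rc [c0 Sc Sc']; apply: RTunit => //.
by split=> //; exact: ST.
Qed.

End Centers.

Theorem theorem3p13 (K : fieldType) (D : subring K) (X : set (subring K))
    (hX : projective_model D X) :
  let Dstar : subring (ratfun K) := Nagata_inter X in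
  let Sstar : set (subring (ratfun K)) := localizations Dstar in
  is_Spec (subring_type Dstar) (model_space Sstar) /\
  exists delta : ringed_morphism (model_space Sstar) (model_space X),
    [/\ forall (S : zariski Sstar) (R : zariski X),
          dominates (ring_of S) (ring_of R) <-> delta S = R,
        forall (U : opens (zariski X)) (s : zsect U) (S : zariski Sstar)
          (US : oset U (delta S)),
          zvalue (mor_sect delta U s) US = to_ratfun (zvalue s US),
        scheme_morphism delta
      & faithfully_flat delta].
Proof.
move=> Dstar Sstar; have SpecD : is_Spec (subring_type Dstar) (model_space Sstar).
  exact: localizations_is_Spec.
split=> //; case: hX => X_local [H [/finite_seqP [r HE] _ XE]]; subst H; subst X.
have SstarP (S : zariski Sstar) : localized Dstar (ring_of S).
  by apply/localizationsP; exact: ring_ofP.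
have locS (S : zariski Sstar) := localized_local (SstarP S).
have locX (R : zariski (W_model D [set` r])) := model_is_local (ring_ofP R).
have center (S : zariski Sstar) : exists R : zariski (W_model D [set` r]),
    dominated (@to_ratfun K) (ring_of R) (ring_of S) /\ poly_fractions (ring_of R) (ring_of S).
  by have [R [XR RS SR]] := Dstar_center X_local (SstarP S); exists (zpoint XR).
(* A center is chosen for every S; [dominatesE] shows that the choice is forced. *)
have [f fP] := choice center.
have fdom S := (fP S).1; have ffrac S := (fP S).2.
have SX (S : zariski Sstar) : carrier (ring_of S) (tofrac ('X : {poly K})).
  by have [Dsub _ _] := SstarP S; apply: Dsub; exact: Dstar_var X_local.
(* The exact contraction of S to K, which is the input that [model_morphism] needs. *)
have fE (S : zariski Sstar) c : carrier (ring_of (f S)) c <-> carrier (ring_of S) (to_ratfun c).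
  have cE := poly_fractions_contract (locS S) (fdom S) (SX S) (ffrac S) c.
  by split=> /cE.
have dominatesE (S : zariski Sstar) R : dominates (ring_of S) (ring_of R) <-> f S = R.
  split=> [/(dominatesP (locS S) (locX R)) RS|<-]; last exact/dominatesP.
  apply: ring_of_inj.
  exact: model_dominated_uniq X_local _ _ _ _ _ (ring_ofP _) (ring_ofP _) (fdom S) RS.
exists (model_morphism fE); split.
- exact: dominatesE.
- by move=> U s S US; exact: zvalue_model_sect.
- split; [exact: is_Spec_scheme SpecD | exact: model_is_scheme |].
  move=> S a; have [_ dom] := (dominatesE S _).2 erefl.
  exact: dom.
- split=> [S|R].
    by apply: flat_of_poly_fractions.
  have [S DS RS] := Dstar_center_surjective X_local (ring_ofP R).
  have SS : Sstar S by exact/localizationsP.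
  exists (zpoint SS); apply/dominatesE/dominatesP => //.
Qed.
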